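(* Let $(u,v,P,\eta)$ be an extreme Stokes wave over infinite depth (a deep-water Stokes wave of greatest height) with wavelength $2\pi$ and speed $c>0$, written in the moving frame, with fluid domain $\Omega=\{(x,y): x\in\mathbb{R},\ -\infty<y<\eta(x)\}$. Then the pressure increases with depth throughout the fluid body, that is, $$P_y<0\quad\text{throughout }\overline{\Omega},$$ where at the crest points of the free surface $P_y$ is understood as the one-sided derivative from below (from within the fluid).
   Context: Constants: $g>0$ (gravity), $c>0$ (wave speed), $P_0$ (atmospheric pressure). The moving frame has coordinates $x=X-ct$, $y=Y$, where $(X,Y)$ are physical coordinates; in it the flow is time-independent. Governing equations. The free surface is the graph $y=\eta(x)$, and the fluid domain is $\Omega=\{(x,y): x\in\mathbb{R},\ -\infty<y<\eta(x)\}$. The velocity $(u,v)$ and the pressure $P$ are functions of $(x,y)$ satisfying in $\Omega$ $$(u-c)u_x+vu_y=-P_x,\qquad (u-c)v_x+vv_y=-P_y-g,$$ $$u_x+v_y=0,\qquad u_y-v_x=0,$$ with boundary conditions $P=P_0$ and $v=(u-c)\eta'$ on $y=\eta(x)$ (the latter away from the crests, where $\eta'$ is not defined), and $(u,v)\to(0,0)$ uniformly in $x$ as $y\to-\infty$. Consequently $u,v$ are harmonic in $\Omega$, and Bernoulli's law $\frac{(u-c)^2+v^2}{2}+gy+P=Q$ holds with $Q$ constant on $\overline{\Omega}$. Stokes wave. $\eta,u,v,P$ are $2\pi$-periodic in $x$; $\eta,u,P$ are even in $x$ and $v$ is odd in $x$. Wave crests (maxima of $\eta$) are located at $x\in2\pi\mathbb{Z}$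 and wave troughs (minima of $\eta$) at $x\in\pi+2\pi\mathbb{Z}$. A regular Stokes wave is a smooth (up to the free surface) such solution with $u-c<0$ on $\overline{\Omega}$. Extreme Stokes wave (wave of greatest height). It is a Stokes wave with a stagnation point at each crest: $u-c\le0$ on $\overline{\Omega}$, with $(u,v)=(c,0)$ at the crests and $u<c$ elsewhere on $\overline{\Omega}$. The velocity field is continuous on $\overline{\Omega}$. Away from the crests the free surface is regular and $u,v,P$ extend smoothly up to it, so their partial derivatives are defined there by extension. At each crest the profile has a corner with contained angle $120^\circ$, and $\eta$ is convex between successive crests (on $[0,2\pi]$). The wave is obtained as a limit of regular Stokes waves in the following sense. Let $\psi$ be the stream function ($\psi_y=u-c$, $\psi_x=-v$, $\psi=0$ on $y=\eta$) and $\phi$ the velocity potential ($\phi_x=u-c$, $\phi_y=v$, normalized so that $\phi=0$ on the crest-line $x=0$). Put $q=-\phi$, $p=-\psi$, and let $\gamma:q+ip\mapsto x+iy$ be the inverse of the resulting conformal map, defined on $\mathbb{R}\times(-\infty,0]$, with height function $h(q,p)=y$. Then there are regular Stokes waves with height functions $h_n$ and maps $\gamma_n$ such that $h_n(\cdot,0)\to h(\cdot,0)$ weakly in the periodic Sobolev space $W^{1,k}_{\rm per}(\mathbb{R})$ for $k\in(1,3)$, hence in the Hölder space $C^{0,\alpha}_{\rm per}(\mathbb{R})$ for $\alpha\in(0,\frac23)$, and $\gamma_n\to\gamma$ in $C^{0,\alpha}_{\rm per}(\mathbb{R}\times(-\infty,0])$ (periodicity with respect to $q$; periods in $q$ are identified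 by rescaling if they differ). *)

(* Defs.v *)
(* Points of the plane are pairs (x, y) : R * R;
   the norm on R * R is the max norm, which induces the same topology and the
   same Hoelder spaces as the Euclidean one. *)
From HB Require Import structures.
From mathcomp Require Import all_boot all_order all_algebra.
From mathcomp Require Import all_classical all_reals all_analysis.

Set Implicit Arguments.
Unset Strict Implicit.
Unset Printing Implicit Defensive.

Import Order.TTheory GRing.Theory Num.Theory.
Import numFieldNormedType.Exports.

Local Open Scope classical_set_scope.
Local Open Scope ring_scope.

Section GravityWaves.
Context {R : realType}.
Implicit Types (g c L k a : R) (S : set R) (eta : R -> R).
Implicit Types (u v P f : R * R -> R) (gam : R * R -> R * R).

Definition ex : R * R := (1, 0).
Definition ey : R * R := (0, 1).

Definition fluid eta : set (R * R) := [set z | z.2 < eta z.1].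

(* The closure of [fluid eta], since eta is always continuous below. *)
Definition cl_fluid eta : set (R * R) := [set z | z.2 <= eta z.1].

(* [cl_fluid eta] without the surface points whose abscissa lies in S. *)
Definition reg_fluid S eta : set (R * R) :=
  [set z | z.2 < eta z.1 \/ (z.2 = eta z.1 /\ ~ S z.1)].

Definition surf eta (x : R) : R * R := (x, eta x).

Definition smooth_off S eta :=
  forall (n : nat) (x : R), ~ S x -> derivable (derive1n n eta) x 1.

(* f is smooth in the fluid and all its partial derivatives (F i j is
   d^(i+j) f / dx^i dy^j) extend continuously to the free surface away from S. *)
Definition smooth_upto S eta f :=
  exists F : nat -> nat -> R * R -> R,
    (forall z, reg_fluid S eta z -> F 0%N 0%N z = f z) /\
    forall i j : nat,
      {within reg_fluid S eta, continuous (F i j)} /\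
      (forall z, fluid eta z ->
         is_derive z ex (F i j) (F i.+1 j z) /\
         is_derive z ey (F i j) (F i j.+1 z)).

(* S collects the abscissae of the surface points where no regularity beyond
   continuity is required. *)
Record water_wave g c (P0 : R) S eta u v P : Prop := WaterWave {
  ww_eta_cont : continuous eta;
  ww_eta_smooth : smooth_off S eta;
  ww_u_cont : {within cl_fluid eta, continuous u};
  ww_v_cont : {within cl_fluid eta, continuous v};
  ww_P_cont : {within cl_fluid eta, continuous P};
  ww_u_smooth : smooth_upto S eta u;
  ww_v_smooth : smooth_upto S eta v;
  ww_P_smooth : smooth_upto S eta P;
  ww_euler_x : forall z, fluid eta z ->
    (u z - c) * 'D_ex u z + v z * 'D_ey u z = - 'D_ex P z;
  ww_euler_y : forall z, fluid eta z ->
    (u z - c) * 'D_ex v z + v z * 'D_ey v z = - 'D_ey P z - g;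
  ww_incompressible : forall z, fluid eta z -> 'D_ex u z + 'D_ey v z = 0;
  ww_irrotational : forall z, fluid eta z -> 'D_ey u z - 'D_ex v z = 0;
  ww_dynamic : forall x : R, P (surf eta x) = P0;
  ww_kinematic : forall x : R, ~ S x ->
    v (surf eta x) = (u (surf eta x) - c) * derive1 eta x;
  ww_deep : forall e : R, 0 < e ->
    \forall y \near -oo, forall x : R, `|u (x, y)| < e /\ `|v (x, y)| < e }.

Definition crest : set R := [set x | exists m : int, x = 2 * pi * m%:~R].
Definition trough : set R := [set x | exists m : int, x = pi + 2 * pi * m%:~R].

Definition periodic_in_x eta f := forall z, cl_fluid eta z ->
  f (z.1 + 2 * pi, z.2) = f z.
Definition even_in_x eta f := forall z, cl_fluid eta z -> f (- z.1, z.2) = f z.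
Definition odd_in_x eta f := forall z, cl_fluid eta z -> f (- z.1, z.2) = - f z.

Record stokes_wave g c (P0 : R) S eta u v P : Prop := StokesWave {
  sw_wave : water_wave g c P0 S eta u v P;
  sw_eta_per : forall x, eta (x + 2 * pi) = eta x;
  sw_u_per : periodic_in_x eta u;
  sw_v_per : periodic_in_x eta v;
  sw_P_per : periodic_in_x eta P;
  sw_eta_even : forall x, eta (- x) = eta x;
  sw_u_even : even_in_x eta u;
  sw_v_odd : odd_in_x eta v;
  sw_P_even : even_in_x eta P;
  sw_crest : forall x, (\forall t \near x, eta t <= eta x) <-> crest x;
  sw_trough : forall x, (\forall t \near x, eta x <= eta t) <-> trough x }.

Record regular_stokes_wave g c (P0 : R) eta u v P : Prop := RegularStokesWave {
  rsw_speed : 0 < c;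
  rsw_stokes : stokes_wave g c P0 set0 eta u v P;
  rsw_no_stagnation : forall z, cl_fluid eta z -> u z - c < 0 }.

Definition stream_function c eta u v (psi : R * R -> R) :=
  [/\ {within cl_fluid eta, continuous psi},
      forall z, fluid eta z ->
        is_derive z ex psi (- v z) /\ is_derive z ey psi (u z - c) &
      forall x : R, psi (surf eta x) = 0].

Definition velocity_potential c eta u v (phi : R * R -> R) :=
  [/\ {within cl_fluid eta, continuous phi},
      forall z, fluid eta z ->
        is_derive z ex phi (u z - c) /\ is_derive z ey phi (v z) &
      forall y : R, y <= eta 0 -> phi (0, y) = 0].

Definition lower_half_plane : set (R * R) := [set w | w.2 <= 0].

(* gam : (q, p) |-> (x, y) is the inverse of (x, y) |-> (- phi, - psi), from the
   closed lower half-plane onto the closed fluid domain. *)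
Definition hodograph_inverse c eta u v gam :=
  exists phi psi,
    [/\ velocity_potential c eta u v phi,
        stream_function c eta u v psi,
        forall z, cl_fluid eta z ->
          lower_half_plane (- phi z, - psi z) /\ gam (- phi z, - psi z) = z &
        forall w, lower_half_plane w ->
          cl_fluid eta (gam w) /\ (- phi (gam w), - psi (gam w)) = w].

Local Notation mu := (@lebesgue_measure R).

Definition smooth_periodic L (f : R -> R) :=
  (forall x, f (x + L) = f x) /\ smooth_off set0 f.

Definition Lper_norm L k (f : R -> R) : \bar R :=
  'N[mu]_k%:E[(EFin \o f) \_ `[0, L]].

Definition Lper L k (f : R -> R) :=
  [/\ measurable_fun setT f, forall x, f (x + L) = f x
    & (Lper_norm L k f < +oo)%E].

(* f belongs to W^{1,k} (L-periodic) and f' is its weak derivative. *)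
Definition W1per_deriv L k (f f' : R -> R) :=
  [/\ Lper L k f, Lper L k f' &
      forall t : R -> R, smooth_periodic L t ->
        \int[mu]_(x in `[0, L]) (f x * derive1 t x) =
        - \int[mu]_(x in `[0, L]) (f' x * t x)].

Definition W1per L k : set (R -> R) := [set f | exists f' : R -> R, W1per_deriv L k f f'].

Definition W1per_dual L k (l : (R -> R) -> R) :=
  (forall (a : R) (f1 f2 : R -> R), W1per L k f1 -> W1per L k f2 ->
     l (fun x => a * f1 x + f2 x) = a * l f1 + l f2) /\
  exists C : R, forall f f' : R -> R, W1per_deriv L k f f' ->
    ((`|l f|)%:E <= C%:E * (Lper_norm L k f + Lper_norm L k f'))%E.

Definition W1per_weak_cvg L k (fn : nat -> R -> R) (f : R -> R) :=
  [/\ forall n, W1per L k (fn n), W1per L k f &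
      forall l, W1per_dual L k l -> l (fn n) @[n --> \oo] --> l f].

(* The C^{0,a} norm of [fn n - f] on D tends to 0. *)
Definition holder_cvg (U V : normedModType R) a (D : set U)
    (fn : nat -> U -> V) (f : U -> V) :=
  forall e : R, 0 < e -> \forall n \near \oo,
    (forall z, D z -> `|fn n z - f z| <= e) /\
    (forall z w, D z -> D w ->
       `|(fn n z - f z) - (fn n w - f w)| <= e * (`|z - w| `^ a)).

(* The wave of speed c with hodograph inverse gam is the limit of the waves of
   speeds cn with hodograph inverses gamn.  As (u, v) vanishes at infinite
   depth, gam (q + 2 * pi * c, p) = gam (q, p) + (2 * pi, 0), so that
   w |-> gamn n ((cn n / c) *: w) has the same period in q as gam.  The maps
   gam themselves are neither periodic nor bounded; their differences are. *)
Definition hodograph_limit c gam (cn : nat -> R) (gamn : nat -> R * R -> R * R) :=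
  let resc n (w : R * R) := gamn n ((cn n / c) *: w) in
  let h (q : R) : R := (gam (q, 0)).2 in
  let hn n (q : R) : R := (resc n (q, 0)).2 in
  (forall k, 1 < k < 3 -> W1per_weak_cvg (2 * pi * c) k hn h) /\
  (forall a, 0 < a < 2 / 3 ->
     @holder_cvg R^o R^o a setT hn h /\
     @holder_cvg (R * R)%type (R * R)%type a lower_half_plane resc gam).

(* The corner of eta at x, with one-sided slopes sl and sr, has contained angle
   th when measured on the fluid side. *)
Definition contained_angle eta (x th : R) :=
  exists sl sr : R,
    [/\ (eta (x + t) - eta x) / t @[t --> 0^'-] --> sl,
        (eta (x + t) - eta x) / t @[t --> 0^'+] --> sr &
        pi + atan sr - atan sl = th].

Record extreme_stokes_wave g c (P0 : R) eta u v P : Prop := ExtremeStokesWave {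
  esw_stokes : stokes_wave g c P0 crest eta u v P;
  esw_stagnation : forall x, crest x ->
    u (surf eta x) = c /\ v (surf eta x) = 0;
  esw_u_le : forall z, cl_fluid eta z -> u z - c <= 0;
  esw_u_lt : forall z, reg_fluid crest eta z -> u z < c;
  esw_corner : forall x, crest x -> contained_angle eta x (2 * pi / 3);
  esw_convex : @convex_function R R^o `[0, 2 * pi] eta;
  esw_limit : exists gam, hodograph_inverse c eta u v gam /\
    exists (cn : nat -> R) (etan : nat -> R -> R)
           (un vn Pn : nat -> R * R -> R) (gamn : nat -> R * R -> R * R),
      [/\ forall n,
            regular_stokes_wave g (cn n) P0 (etan n) (un n) (vn n) (Pn n),
          forall n, hodograph_inverse (cn n) (etan n) (un n) (vn n) (gamn n) &
          hodograph_limit c gam cn gamn] }.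

End GravityWaves.

(* Main.v *)
(* Let F = (c - u) + i v, an analytic function of x + i y.  Euler's equations give
   P_y = - g + Im (F' conj F).  With F F' = N + i T one has
     |F|^2 Im (F' conj F) = ((c - u)^2 - v^2) T - 2 (c - u) v N,
   so P_y <= - g / 2 follows once T <= g / 2 in the fluid and v >= 0, c - u >= v,
   N >= 0 over the half period 0 <= x <= pi.
   In the hodograph variable w = q + i p = - (phi + i psi) one has dw/dz = F, so
   d(F^3)/dw = 3 (N + i T).  On the surface F = (c - u) (1 - i eta') and, by
   Bernoulli's law, |F|^2 = 2 g (eta 0 - eta); since eta is convex between crests
   with |eta'| <= tan (pi / 6), there Re F^3 increases from crest to trough and
   Im F^3 - (3 g / 2) q decreases.  The maximum principle in the half plane
   p <= 0, applied to the differences of Im F^3 under translations in q and of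
   Re F^3 under reflections in q, carries both facts into the fluid.  Working
   with differences of F^3, which is continuous and bounded up to the crests,
   avoids any control of F' near the crests.
   On the crest line P_y = - g + T and T_y = N_x >= 0, so that P_y is monotone
   there and has a limit at the crest, which is at most - g / 2. *)
Require Import Defs.
From mathcomp Require Import all_boot all_order all_algebra.
From mathcomp Require Import all_classical all_reals all_analysis.
From mathcomp Require Import ring lra zify.
Import Order.TTheory GRing.Theory Num.Theory.
Import numFieldNormedType.Exports.
Local Open Scope classical_set_scope.
Local Open Scope ring_scope.

Set Implicit Arguments.
Unset Strict Implicit.
Unset Printing Implicit Defensive.

(** * Calculus of one and two real variables *)

(** The cube and the constant g / 2 come from the corner. In the exact 120 degree corner flow, with
    z and w measured from the crest, F^2 is a multiple of z and w a multiple of z^(3/2), so F^3 is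
    linear in w, with N = 0 and T = g / 2 throughout. The bound T <= g / 2 thus compares the wave
    with its own corner flow, and the inequality for the surface slope s behind it, 2 s^2 (3 - s^2)
    <= (1 + s^2)^2 when 3 s^2 <= 1, is an equality exactly at the corner slope. Cubing also turns
    the bound of 30 degrees on |arg F| at the surface into Re F^3 >= 0. The hodograph plane is
    needed because a general translation or reflection in x does not preserve the fluid domain,
    whereas those in q preserve the half plane. The price is the regularity of the inverse map: it
    is given only as a pointwise inverse, so its continuity has to come from properness and its
    derivatives from inverting the Jacobian. *)

Definition der {R : realType} (f : R -> R) (x d : R) := is_derive x 1 f d.

Section Calculus.
Context {R : realType}.
Implicit Types (f : R * R -> R) (z : R * R).

Lemma within_comp (T U V : topologicalType) (A : set U) (I : set T)
    (f : U -> V) (k : T -> U) :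
  {within A, continuous f} -> {within I, continuous k} ->
  (forall s, I s -> A (k s)) -> {within I, continuous (f \o k)}.
Proof.
move=> /subspace_continuousP cf /subspace_continuousP ck IA.
apply/subspace_continuousP => x Ix.
move=> B /(cf _ (IA _ Ix)); rewrite /= !nbhs_simpl /within /= => HB.
have := ck x Ix _ HB; rewrite /= !nbhs_simpl /within /=.
by apply: filterS => y h Iy; exact: h Iy (IA _ Iy).
Qed.

Lemma within_for (T U : topologicalType) (A : set T) (f : T -> U) (x : T) :
  {within A, continuous f} -> nbhs x A -> {for x, continuous f}.
Proof.
move=> /subspace_continuousP cf nA.
have /cf := nbhs_singleton nA.
move=> h B HB; have hh : nbhs x (fun y => A y -> B (f y)) := h _ HB.
by apply: filterS2 nA hh => y Ay; apply.
Qed.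

Lemma is_derive_exE f z d : is_derive z ex f d ->
  der (fun s : R => f (s, z.2)) z.1 d.
Proof.
move=> [h1 h2]; move: h1 h2; rewrite /derivable /derive.
have -> : (fun h : R => h^-1 *: ((f \o shift z) (h *: ex) - f z)) =
  (fun h : R => h^-1 *: (((fun s : R => f (s, z.2)) \o shift (z.1 : R))
    (h *: (1 : R)) - f (z.1, z.2))).
  apply/funext => h; case: z => x y /=; rewrite /ex.
  congr (_ *: (f _ - _)).
  by apply/pair_equal_spec; split => //=; rewrite [h *: 0]mulr0 add0r.
by move=> h1 h2; constructor.
Qed.

Lemma is_derive_eyE f z d : is_derive z ey f d ->
  der (fun s : R => f (z.1, s)) z.2 d.
Proof.
move=> [h1 h2]; move: h1 h2; rewrite /derivable /derive.
have -> : (fun h : R => h^-1 *: ((f \o shift z) (h *: ey) - f z)) =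
  (fun h : R => h^-1 *: (((fun s : R => f (z.1, s)) \o shift (z.2 : R))
    (h *: (1 : R)) - f (z.1, z.2))).
  apply/funext => h; case: z => x y /=; rewrite /ey.
  congr (_ *: (f _ - _)).
  by apply/pair_equal_spec; split => //=; rewrite [h *: 0]mulr0 add0r.
by move=> h1 h2; constructor.
Qed.

Lemma der_val (f : R -> R) (x d e : R) : der f x d -> d = e -> der f x e.
Proof. by move=> h <-. Qed.

Lemma der_near (f g : R -> R) (x d : R) :
  (\forall s \near x, f s = g s) -> der f x d -> der g x d.
Proof. exact: near_eq_is_derive. Qed.

Lemma der_continuous (f : R -> R) (x d : R) : der f x d -> {for x, continuous f}.
Proof. by move=> [h _]; apply: differentiable_continuous; apply/derivable1_diffP. Qed.

Lemma der_cst (l x : R) : der (fun=> l) x 0.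
Proof. exact: is_derive_cst. Qed.

Lemma der_id (x : R) : der (fun s => s) x 1.
Proof. exact: is_derive_id. Qed.

Lemma derD (f g : R -> R) (x a b : R) :
  der f x a -> der g x b -> der (fun s => f s + g s) x (a + b).
Proof. exact: is_deriveD. Qed.

Lemma derN (f : R -> R) (x a : R) : der f x a -> der (fun s => - f s) x (- a).
Proof. exact: is_deriveN. Qed.

Lemma derB (f g : R -> R) (x a b : R) :
  der f x a -> der g x b -> der (fun s => f s - g s) x (a - b).
Proof. exact: is_deriveB. Qed.

Lemma derM (f g : R -> R) (x a b : R) :
  der f x a -> der g x b -> der (fun s => f s * g s) x (a * g x + f x * b).
Proof.
move=> h1 h2; have := @is_deriveM _ _ f g x 1 _ _ h1 h2.
by rewrite addrC [g x *: a]mulrC.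
Qed.

Lemma derZ (f : R -> R) (l x a : R) :
  der f x a -> der (fun s => l * f s) x (l * a).
Proof. exact: is_deriveZ. Qed.

Lemma derV (f : R -> R) (x a : R) : f x != 0 ->
  der f x a -> der (fun s => (f s)^-1) x (- a / f x ^+ 2).
Proof.
move=> f0 h; have := @is_deriveV _ f x a 1 f0 h.
by rewrite /GRing.scale /= mulNr -mulrN mulrC.
Qed.

Lemma der_comp (f g : R -> R) (x a b : R) :
  der f (g x) a -> der g x b -> der (fun s => f (g s)) x (a * b).
Proof. exact: is_derive1_comp. Qed.

Lemma der_within (f f' : R -> R) (a b : R) :
  (forall x, a <= x <= b -> der f x (f' x)) -> {within `[a, b], continuous f}.
Proof.
move=> h; apply: continuous_in_subspaceT => x /[1!inE] /=.
by rewrite in_itv /= => /h /der_continuous.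
Qed.

Lemma mvt (f f' : R -> R) (a b : R) : a < b ->
  (forall x, a < x < b -> der f x (f' x)) -> {within `[a, b], continuous f} ->
  exists2 c, a < c < b & f b - f a = f' c * (b - a).
Proof.
move=> ab h c; have h' x : x \in `]a, b[ -> der f x (f' x).
  by rewrite in_itv /=; exact: h.
have [x xab ->] := MVT ab h' c.
by exists x => //; move: xab; rewrite in_itv.
Qed.

Lemma mvt_between (f f' : R -> R) (a b : R) :
  (forall x, Num.min a b <= x <= Num.max a b -> der f x (f' x)) ->
  exists2 c, Num.min a b <= c <= Num.max a b & f b - f a = f' c * (b - a).
Proof.
case: (ltgtP a b) => [ab|ab|->] h.
- have h' x : a < x < b -> der f x (f' x).
    by move=> /andP[? ?]; apply: h; rewrite !ltW.
  have [c cab e] := mvt ab h' (der_within h).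
  by exists c => //; case/andP: cab => ? ?; rewrite !ltW.
- have h' x : b < x < a -> der f x (f' x).
    by move=> /andP[? ?]; apply: h; rewrite !ltW.
  have [c cab e] := mvt ab h' (der_within h).
  exists c; first by case/andP: cab => ? ?; rewrite !ltW.
  by rewrite -[LHS]opprB e; ring.
- by exists b; rewrite ?lexx // !subrr mulr0.
Qed.

Lemma nondecreasing_der (f f' : R -> R) (a b : R) : a <= b ->
  (forall x, a < x < b -> der f x (f' x)) ->
  (forall x, a < x < b -> 0 <= f' x) -> {within `[a, b], continuous f} ->
  f a <= f b.
Proof.
rewrite le_eqVlt => /predU1P[->//|ab] h p c.
have [x xab e] := mvt ab h c.
by rewrite -subr_ge0 e mulr_ge0 ?p // subr_ge0 ltW.
Qed.

(** Second-derivative test assuming differentiability of [a] at the single point [x]. Fermat gives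
    [a x = 0]; if [c > 0], then [a] is positive just to the right of [x], and the mean value theorem
    puts [f] above [f x] there. *)
Lemma der_max2 (f a : R -> R) (x c : R) :
  (\forall s \near x, der f s (a s)) -> der a x c ->
  (\forall s \near x, f s <= f x) -> c <= 0.
Proof.
move=> df da fm; rewrite leNgt; apply/negP => c0.
have [e /= e0 he] : exists2 e : R, 0 < e & forall s, `|s - x| < e ->
    der f s (a s) /\ f s <= f x.
  have [e /= e0 he] := filterI df fm.
  by exists e => // s se; apply: he; rewrite /= distrC.
have ax : a x = 0.
  have xe : x - e <= x + e by lra.
  have xin : x \in `]x - e, x + e[ by rewrite in_itv /=; apply/andP; lra.
  have hin t : t \in `]x - e, x + e[ -> `|t - x| < e.
    rewrite in_itv /= => /andP[? ?]; rewrite ltr_norml; apply/andP; lra.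
  have hd t : t \in `]x - e, x + e[ -> derivable f t 1.
    by move=> /hin /he[[]].
  have hm t : t \in `]x - e, x + e[ -> f t <= f x by move=> /hin /he[].
  have [_ <-] := derive1_at_max xe hd xin hm.
  by have [|[_ ->]] := he x; rewrite ?subrr ?normr0.
have /is_derive1_caratheodory[k [k1 k2 k3]] := da.
have [d /= d0 hd] : exists2 d : R, 0 < d & forall s, `|s - x| < d -> 0 < k s.
  have : \forall s \near x, 0 < k s.
    by move: c0; rewrite -k3 => /(cvgr_gt _ k2).
  by move=> [d /= d0 hd]; exists d => // s sd; apply: hd; rewrite /= distrC.
pose m := Num.min e d / 2.
have m0 : 0 < m by rewrite divr_gt0 // lt_min e0 d0.
have [me md] : m < e /\ m < d.
  have : m < Num.min e d by rewrite ltr_pdivrMr // ltr_pMr ?lt_min ?e0 //; lra.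
  by rewrite lt_min => /andP[].
have xm : x < x + m by lra.
have H s : x <= s <= x + m -> `|s - x| <= m.
  by move=> /andP[? ?]; rewrite ler_norml; apply/andP; lra.
have hd' s : x <= s <= x + m -> der f s (a s).
  by move=> hs; case: (he s) => //; apply: le_lt_trans me; exact: H.
have hd2 s : x < s < x + m -> der f s (a s).
  by move=> /andP[? ?]; apply: hd'; rewrite !ltW.
have [s /andP[s1 s2] es] := mvt xm hd2 (der_within hd').
have : f (x + m) <= f x.
  by case: (he (x + m)) => //; apply: le_lt_trans me; apply: H; lra.
apply/negP; rewrite -ltNge -subr_gt0 es mulr_gt0 //; last by lra.
have -> : a s = k s * (s - x) by rewrite -k1 ax subr0.
apply: mulr_gt0; last by lra.
by apply: hd; apply: le_lt_trans md; apply: H; rewrite !ltW.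
Qed.

Lemma near_ball (x : R) (P : R -> Prop) : (\forall s \near x, P s) <->
  exists2 d : R, 0 < d & forall s, `|s - x| < d -> P s.
Proof.
split=> [[d /= d0 h]|[d d0 h]]; exists d => //= s hs; apply: h => //=; by rewrite distrC.
Qed.

(** Converts signs of finite differences, which is what the maximum principle delivers, into signs
    of derivatives. *)
Lemma der_ge0_right (f : R -> R) (x d e : R) : 0 < e -> der f x d ->
  (forall t, 0 < t < e -> f x <= f (x + t)) -> 0 <= d.
Proof.
move=> e0 /is_derive1_caratheodory[k [kE ck <-]] h; rewrite leNgt; apply/negP => k0.
have [d0 d00 hd] := (near_ball x (fun t => k t < 0)).1 (cvgr_lt _ ck _ k0).
pose t := Num.min d0 e / 2.
have t0 : 0 < t by rewrite divr_gt0 // lt_min d00 e0.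
have : t < Num.min d0 e by rewrite ltr_pdivrMr // ltr_pMr ?lt_min ?d00 //; lra.
rewrite lt_min => /andP[td te].
have : k (x + t) < 0 by apply: hd; rewrite [x + t]addrC addrK gtr0_norm.
have := h t; rewrite t0 te => /(_ isT); rewrite -subr_ge0 kE [x + t]addrC addrK.
by nra.
Qed.

Lemma near_box z (P : R * R -> Prop) : (\forall z' \near z, P z') <->
  exists2 d : R, 0 < d &
    forall x y, `|x - z.1| < d -> `|y - z.2| < d -> P (x, y).
Proof.
split.
  move=> [[U V] /= [[d1 /= d10 hU] [d2 /= d20 hV]] UV].
  exists (Num.min d1 d2); first by rewrite lt_min d10.
  move=> x y; rewrite !lt_min ![`|_ - z.1|]distrC ![`|_ - z.2|]distrC.
  move=> /andP[h1 _] /andP[_ h2].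
  by apply: (UV (x, y)); split => /=; [exact: hU|exact: hV].
move=> [d d0 h]; exists (ball z.1 d, ball z.2 d) => /=.
  by split; exact: nbhsx_ballx.
by move=> [x y] [/= h1 h2]; apply: h; rewrite distrC.
Qed.

Lemma between_dist (a b s : R) :
  Num.min a b <= s <= Num.max a b -> `|s - a| <= `|b - a|.
Proof.
case: (leP a b) => h /andP[h1 h2]; rewrite ler_norml.
  by rewrite ger0_norm ?subr_ge0 //; lra.
by rewrite ltr0_norm ?subr_lt0 //; lra.
Qed.

Lemma continuous_pair (X Y : R -> R) (t : R) : {for t, continuous X} ->
  {for t, continuous Y} -> {for t, continuous (fun s => (X s, Y s))}.
Proof.
move=> cX cY.
exact: (@cvg_pair _ _ _ _ (nbhs (X t)) (nbhs (Y t)) _ _ _ X Y cX cY).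
Qed.

Definition partials f (f1 f2 : R * R -> R) z :=
  der (fun s => f (s, z.2)) z.1 (f1 z) /\ der (fun s => f (z.1, s)) z.2 (f2 z).

Definition C1 f (f1 f2 : R * R -> R) z :=
  [/\ \forall z' \near z, partials f f1 f2 z',
      {for z, continuous f1} & {for z, continuous f2}].

(** The classical step from continuous partial derivatives to differentiability: the increment is
    split at the corner [(z.1, z'.2)] and the mean value theorem is applied on each side. With the
    factors [A] and [B] continuous at [z], the chain rule and the inverse function rule become
    algebra plus continuity. *)
Lemma C1_caratheodory f f1 f2 z : C1 f f1 f2 z ->
  exists A B : R * R -> R,
    [/\ forall z', f z' - f z = A z' * (z'.1 - z.1) + B z' * (z'.2 - z.2),
        {for z, continuous A}, {for z, continuous B}, A z = f1 z & B z = f2 z].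
Proof.
move=> [hp c1 c2].
pose A z' := if z'.1 == z.1 then f1 z else (f z' - f (z.1, z'.2)) / (z'.1 - z.1).
pose B z' := if z'.2 == z.2 then f2 z else (f (z.1, z'.2) - f z) / (z'.2 - z.2).
have Az : A z = f1 z by rewrite /A eqxx.
have Bz : B z = f2 z by rewrite /B eqxx.
exists A, B; split => //.
- move=> z'; rewrite /A /B.
  have -> : f z' - f z = (f z' - f (z.1, z'.2)) + (f (z.1, z'.2) - f z) by ring.
  congr (_ + _).
    case: eqP => [e|/eqP]; last by rewrite -subr_eq0 => /divfK ->.
    by rewrite -e -surjective_pairing e !subrr mulr0.
  case: eqP => [e|/eqP]; last by rewrite -subr_eq0 => /divfK ->.
  by rewrite e -surjective_pairing !subrr mulr0.
- apply/cvgrPdist_lt => e e0.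
  have : \forall z' \near z, partials f f1 f2 z' /\ `|f1 z - f1 z'| < e.
    by apply: filterI => //; move/cvgrPdist_lt : c1 => /(_ _ e0).
  move=> /near_box[d d0 hd]; apply/near_box; exists d => // x y hx hy.
  rewrite Az /A /=; case: eqP => [_|/eqP ne]; first by rewrite subrr normr0.
  have [|s hs ->] := @mvt_between (fun s => f (s, y)) (fun s => f1 (s, y)) z.1 x.
    move=> s /between_dist sx.
    by case: (hd s y (le_lt_trans sx hx) hy) => -[].
  rewrite mulfK ?subr_eq0 //.
  by case: (hd s y (le_lt_trans (between_dist hs) hx) hy).
- apply/cvgrPdist_lt => e e0.
  have : \forall z' \near z, partials f f1 f2 z' /\ `|f2 z - f2 z'| < e.
    by apply: filterI => //; move/cvgrPdist_lt : c2 => /(_ _ e0).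
  move=> /near_box[d d0 hd]; apply/near_box; exists d => // x y hx hy.
  rewrite Bz /B /=; case: eqP => [_|/eqP ne]; first by rewrite subrr normr0.
  have z1 : `|z.1 - z.1| < d by rewrite subrr normr0.
  have [|s hs e'] := @mvt_between (fun s => f (z.1, s)) (fun s => f2 (z.1, s)) z.2 y.
    move=> s /between_dist sx.
    by case: (hd z.1 s z1 (le_lt_trans sx hy)) => -[].
  rewrite [in f z](surjective_pairing z) e' mulfK ?subr_eq0 //.
  by case: (hd z.1 s z1 (le_lt_trans (between_dist hs) hy)).
Qed.

Lemma der_comp2 f f1 f2 (X Y : R -> R) (t a b : R) :
  C1 f f1 f2 (X t, Y t) -> der X t a -> der Y t b ->
  der (fun s => f (X s, Y s)) t (f1 (X t, Y t) * a + f2 (X t, Y t) * b).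
Proof.
move=> /C1_caratheodory[A [B [fE cA cB AE BE]]] dX dY.
have cXY : {for t, continuous (fun s => (X s, Y s))}.
  by apply: continuous_pair; [exact: der_continuous dX|exact: der_continuous dY].
have /is_derive1_caratheodory[g [gE cg g0]] := dX.
have /is_derive1_caratheodory[h [hE ch h0]] := dY.
apply/is_derive1_caratheodory.
exists (fun s => A (X s, Y s) * g s + B (X s, Y s) * h s); split.
- by move=> s; rewrite fE /= gE hE; ring.
- by apply: cvgD; apply: cvgM => //; exact: (continuous_comp cXY).
- by rewrite AE BE g0 h0.
Qed.

(** Inserting Caratheodory factors of [q] and [p] gives a 2 by 2 linear system for the increments of
    [X] and [Y], solved by Cramer's rule; its determinant [j s] tends to [J], hence is nonzero
    nearby. Only continuity of the inverse curve [(X, Y)] is assumed, its differentiability is the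
    conclusion. *)
Lemma der_inverse (q p q1 q2 p1 p2 : R * R -> R) (X Y : R -> R) (t k l : R) :
  let z := (X t, Y t) in let J := q1 z * p2 z - q2 z * p1 z in
  C1 q q1 q2 z -> C1 p p1 p2 z -> J != 0 ->
  {for t, continuous X} -> {for t, continuous Y} ->
  (\forall s \near t, q (X s, Y s) - q z = k * (s - t) /\
                      p (X s, Y s) - p z = l * (s - t)) ->
  der X t ((p2 z * k - q2 z * l) / J) /\ der Y t ((q1 z * l - p1 z * k) / J).
Proof.
move=> z J /C1_caratheodory[A [B [qE cA cB AE BE]]].
move=> /C1_caratheodory[C [D [pE cC cD CE DE]]] J0 cX cY hqp.
have cXY : {for t, continuous (fun s => (X s, Y s))} by apply: continuous_pair.
have cc (G : R * R -> R) : {for z, continuous G} ->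
    {for t, continuous (fun s => G (X s, Y s))}.
  by move=> cG; apply: (continuous_comp cXY).
move: (cc _ cA) (cc _ cB) (cc _ cC) (cc _ cD) => {cc}.
set a := fun s => A (X s, Y s); set b := fun s => B (X s, Y s).
set c := fun s => C (X s, Y s); set d := fun s => D (X s, Y s).
move=> ca cb cc cd.
pose j s := a s * d s - b s * c s.
have jt : j t = J by rewrite /j /a /b /c /d AE BE CE DE.
have cj : {for t, continuous j} by apply: cvgB; exact: cvgM.
have nj : \forall s \near t, j s != 0.
  by move: J0; rewrite -jt => /(cvgr_neq0 _ cj).
have cjV : {for t, continuous (fun s => (j s)^-1)}.
  by apply: cvgV => //; rewrite jt.
have key (G m : R -> R) : {for t, continuous m} ->
    (\forall s \near t, G s - G t = m s * (s - t)) -> der G t (m t).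
  move=> cm hG; apply: (@der_near (fun s => G t + m s * (s - t))).
    by apply: filterS hG => s <-; rewrite addrC subrK.
  apply/is_derive1_caratheodory; exists m; split => //.
  by move=> s; rewrite subrr mulr0 addr0 addrAC subrr add0r.
have hs : \forall s \near t, [/\ j s != 0,
    k * (s - t) = a s * (X s - X t) + b s * (Y s - Y t) &
    l * (s - t) = c s * (X s - X t) + d s * (Y s - Y t)].
  near=> s; split; first by near: s.
    have [<- _] : q (X s, Y s) - q z = k * (s - t) /\
        p (X s, Y s) - p z = l * (s - t) by near: s.
    by rewrite qE.
  have [_ <-] : q (X s, Y s) - q z = k * (s - t) /\
      p (X s, Y s) - p z = l * (s - t) by near: s.
  by rewrite pE.
split.
  have -> : (p2 z * k - q2 z * l) / J = (d t * k - b t * l) / j t.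
    by rewrite jt /d /b DE BE.
  apply: (key _ (fun s => (d s * k - b s * l) / j s)).
    by apply: cvgM => //; apply: cvgB; apply: cvgM => //; exact: cvg_cst.
  apply: filterS hs => s [j0 e1 e2].
  apply: (mulfI j0); transitivity ((d s * k - b s * l) * (s - t)); last by field.
  rewrite [RHS]mulrBl -!mulrA e1 e2.
  by rewrite /j; ring.
have -> : (q1 z * l - p1 z * k) / J = (a t * l - c t * k) / j t.
  by rewrite jt /a /c AE CE.
apply: (key _ (fun s => (a s * l - c s * k) / j s)).
  by apply: cvgM => //; apply: cvgB; apply: cvgM => //; exact: cvg_cst.
apply: filterS hs => s [j0 e1 e2].
apply: (mulfI j0); transitivity ((a s * l - c s * k) * (s - t)); last by field.
  rewrite [RHS]mulrBl -!mulrA e1 e2.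
by rewrite /j; ring.
Unshelve. all: by end_near. Qed.

End Calculus.

(** * The maximum principle *)

Section MaximumPrinciple.
Context {R : realType}.
Implicit Types (f h : R * R -> R) (z w : R * R).

(* The Laplacian vanishes at z; second derivatives are only taken along the two
   coordinate lines through z. *)
Definition harmonic_at h z := exists (a b : R -> R) (c : R),
  [/\ \forall s \near z.1, der (fun s => h (s, z.2)) s (a s), der a z.1 c,
      \forall s \near z.2, der (fun s => h (z.1, s)) s (b s) & der b z.2 (- c)].

Lemma harmonic_at_lin f h (k l : R) z : harmonic_at f z -> harmonic_at h z ->
  harmonic_at (fun w => f w + k * h w + l) z.
Proof.
have H (u v a b : R -> R) s : der u s (a s) -> der v s (b s) ->
    der (fun s => u s + k * v s + l) s (a s + k * b s).
  move=> h1 h2; have := @is_deriveD _ _ _ _ _ s 1 _ _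
    (@is_deriveD _ _ _ _ _ s 1 _ _ h1 (@is_deriveZ _ _ _ _ k s 1 _ h2))
    (is_derive_cst l s 1).
  by rewrite addr0.
have H' (u v : R -> R) s a b : der u s a -> der v s b ->
    der (fun s => u s + k * v s) s (a + k * b).
  move=> h1 h2.
  exact: (@is_deriveD _ _ _ _ _ s 1 _ _ h1 (@is_deriveZ _ _ _ _ k s 1 _ h2)).
move=> [a [b [c [a1 a2 b1 b2]]]] [a' [b' [c' [a1' a2' b1' b2']]]].
exists (fun s => a s + k * a' s), (fun s => b s + k * b' s), (c + k * c'); split.
- by apply: filterS2 a1 a1' => s; exact: H.
- exact: H'.
- by apply: filterS2 b1 b1' => s; exact: H.
- by apply: (der_val (H' _ _ _ _ _ b2 b2')); rewrite opprD mulrN.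
Qed.

Lemma der_affine (u : R -> R) (k l s d : R) : der u (k * s + l) d ->
  der (fun s => u (k * s + l)) s (k * d).
Proof.
move=> hu.
have h2 : der (fun s => k * s + l) s k.
  have := @is_deriveD _ _ _ _ _ s 1 _ _ (@is_deriveZ _ _ _ _ k s 1 _
    (is_derive_id s 1)) (is_derive_cst l s 1).
  by rewrite addr0 [k *: 1]mulr1.
by rewrite mulrC; exact: (@is_derive1_comp R u (fun s => k * s + l) s d k hu h2).
Qed.

Lemma near_affine (k l s : R) (P : R -> Prop) :
  (\forall t \near k * s + l, P t) -> \forall t \near s, P (k * t + l).
Proof.
have c : {for s, continuous (fun t : R => k * t + l)}.
  by apply: cvgD; [apply: cvgM; [exact: cvg_cst|exact: cvg_id]|exact: cvg_cst].
exact: (c P).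
Qed.

(** The condition [k * k = 1] covers both translations ([k = 1]) and reflections ([k = -1]). *)
Lemma harmonic_at_affine h (k l : R) z : k * k = 1 ->
  harmonic_at h (k * z.1 + l, z.2) ->
  harmonic_at (fun w => h (k * w.1 + l, w.2)) z.
Proof.
move=> kk [a [b [c /= [a1 a2 b1 b2]]]].
exists (fun s => k * a (k * s + l)), b, c; split => //=.
- move: (near_affine a1); apply: filterS => s.
  by move=> /(der_affine (u := fun s => h (s, z.2))).
- have := @is_deriveZ _ _ _ _ k _ _ _ (der_affine a2).
  by rewrite scalerA [k * k]kk scale1r.
Qed.

(** A Phragmen-Lindelof form: [G] may be unbounded sideways and downwards, and boundedness above
    replaces conditions at infinity. Boundary conditions are packed into the last hypothesis: a
    point where [h] is positive must be interior, with vanishing Laplacian, so boundary points are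
    dealt with by showing [h <= 0] there. If [h w0 > 0], then [h] minus a small multiple of the
    barrier attains a positive maximum, and the second-derivative tests along the two axes
    contradict strict superharmonicity. *)
Lemma max_principle (G : set (R * R)) h (Y K : R) :
  closed G -> (forall z, G z -> z.2 <= Y) ->
  {within G, continuous h} -> (forall z, G z -> h z <= K) ->
  (forall z, G z -> 0 < h z -> nbhs z G /\ harmonic_at h z) ->
  forall z, G z -> h z <= 0.
Proof.
move=> clG GY ch hK hG w0 Gw0; rewrite leNgt; apply/negP => h0.
(* [ln (x^2 + m^2)] is harmonic and tends to infinity; the term [- 1 / m] makes
   the barrier [B] strictly superharmonic. *)
pose m (y : R) := Y + 1 - y.
pose D z := z.1 ^+ 2 + m z.2 ^+ 2.
pose B z := ln (D z) - (m z.2)^-1 + 1.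
have m1 z : G z -> 1 <= m z.2 by move=> /GY; rewrite /m; lra.
have D1 z : 1 <= m z.2 -> 1 <= D z.
  by move=> mz; rewrite /D; nra.
have mV z : 1 <= m z.2 -> (m z.2)^-1 <= 1.
  by move=> mz; rewrite invf_le1 //; lra.
have B0 z : G z -> 0 <= B z.
  move=> Gz; have := mV _ (m1 _ Gz); have := ln_ge0 (D1 _ (m1 _ Gz)).
  by rewrite /B; lra.
(* Small enough that [e * B w0] stays below [h w0 / 2]; the [+ 1] keeps the denominator positive
   when [B w0 = 0]. *)
pose e := h w0 / (2 * (B w0 + 1)).
have Bw0 := B0 _ Gw0.
have e0 : 0 < e by rewrite divr_gt0 //; lra.
have K0 : 0 < K by apply: lt_le_trans h0 _; exact: hK.
pose k z := h z - e * B z.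
have k0 : 0 < k w0.
  have : e * (B w0 + 1) = h w0 / 2 by rewrite /e; field; lra.
  by rewrite /k; nra.
(* Chosen with [e * ln N = K]: outside the box [Q] of size [N] one has [D z >= N], hence
   [e * B z >= K >= h z], and [k] cannot be positive there. *)
pose N := expR (K / e).
have N1 : 1 <= N by rewrite -expR0 ler_expR divr_ge0 // ltW.
pose Q : set (R * R) := `[- N, N]%classic `*` `[Y - N, Y]%classic.
have kQ z : G z -> 0 < k z -> Q z.
  move=> Gz kz; apply: contrapT => nQ.
  have : e * B z < K by have := hK _ Gz; move: kz; rewrite /k; lra.
  apply/negP; rewrite -leNgt mulrC -ler_pdivrMr //.
  have -> : K / e = ln N by rewrite expRK.
  have mz := m1 _ Gz.
  apply: (@le_trans _ _ (ln (D z))); last by have := mV _ mz; rewrite /B; lra.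
  have D0 := D1 _ mz.
  rewrite ler_ln ?posrE; [|lra|lra].
  have : ~~ (`|z.1| <= N) \/ ~~ (Y - N <= z.2).
    apply/orP; rewrite -negb_and; apply/negP => /andP[h1 h2]; apply: nQ.
    split => /=; rewrite in_itv /=; first by rewrite -ler_norml.
    by rewrite h2 GY.
  rewrite -!ltNge /D => -[h1|h1].
    have : N ^+ 2 <= z.1 ^+ 2 by rewrite -(real_normK (num_real z.1)); nra.
    by nra.
  have : N <= m z.2 by rewrite /m; lra.
  by nra.
have cQ : compact Q by apply: compact_setX; exact: segment_compact.
have cGQ : compact (G `&` Q).
  by rewrite setIC; exact: compact_closedI.
have cB z : 1 <= m z.2 -> {for z, continuous B}.
  move=> mz.
  have cm : {for z, continuous (fun z => m z.2)}.
    by apply: cvgB; [exact: cvg_cst|exact: cvg_snd].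
  have cD : {for z, continuous D}.
    apply: cvgD; apply: cvgM => //; exact: cvg_fst.
  apply: cvgD; last exact: cvg_cst.
  apply: cvgB.
    apply: (continuous_comp cD); apply: continuous_ln.
    by have := D1 _ mz; lra.
  by apply: cvgV => //; lra.
have ck : {within G `&` Q, continuous k}.
  move=> x; apply: cvgB.
    exact: (continuous_subspaceW (@subIsetl _ G Q) ch).
  apply: cvgM; first exact: cvg_cst.
  move: x; apply: continuous_in_subspaceT => x /[1!inE] -[Gx _].
  by apply: cB; exact: m1.
have [|w1 /[1!inE] -[Gw1 Qw1] w1max] := compact_EVT_max _ cGQ ck.
  by exists w0; split => //; exact: kQ.
have kmax z : G z -> k z <= k w1.
  move=> Gz; have [kz|kz] := leP (k z) 0.
    apply: le_trans kz _; apply: le_trans (ltW k0) _.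
    by apply: w1max; rewrite inE; split => //; exact: kQ.
  by apply: w1max; rewrite inE; split => //; exact: kQ.
have kw1 : 0 < k w1 by apply: lt_le_trans k0 _; exact: kmax.
have [|nG [a [b [c [a1 a2 b1 b2]]]]] := hG _ Gw1.
  have := B0 _ Gw1; move: kw1; rewrite /k.
  by have := e0; nra.
have mw1 := m1 _ Gw1.
have m1n0 : m w1.2 != 0 by lra.
have derm s : der m s (-1).
  have := @is_deriveB _ _ _ _ _ s 1 _ _ (is_derive_cst (Y + 1) s 1) (is_derive_id s 1).
  by rewrite sub0r.
move: nG => /near_box[d d0 hd].
have hx : \forall s \near w1.1, k (s, w1.2) <= k w1.
  apply/near_ball; exists d => // s sd; apply: kmax; apply: hd => //.
  by rewrite subrr normr0.
have hy : \forall s \near w1.2, k (w1.1, s) <= k w1.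
  apply/near_ball; exists d => // s sd; apply: kmax; apply: hd => //.
  by rewrite subrr normr0.
pose x1 := w1.1; pose y1 := w1.2; pose M := m y1.
have Dx (s : R) : 0 < D (s, y1).
  by rewrite /D /= -/M; have : 1 <= M by []; nra.
have dB1 s : der (fun s => B (s, y1)) s (2 * s / D (s, y1)).
  have q : der (fun s => s * s + M * M) s (1 * s + s * 1 + 0).
    by apply: derD; [apply: derM; exact: der_id|exact: der_cst].
  have := @der_comp R (@ln R) (fun s => s * s + M * M) s _ _ (is_derive1_ln _) q.
  rewrite -!expr2 => /(_ (Dx s)) l.
  apply: (der_val (derD (derB l (der_cst M^-1 s)) (der_cst 1 s))).
  have := Dx s; rewrite /D /= -/M => ?; field; lra.
have dB2 : der (fun s => 2 * s / D (s, y1)) x1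
    ((2 * D w1 - 4 * x1 ^+ 2) / D w1 ^+ 2).
  have q : der (fun s => s * s + M * M) x1 (1 * x1 + x1 * 1 + 0).
    by apply: derD; [apply: derM; exact: der_id|exact: der_cst].
  have q0 : x1 * x1 + M * M != 0 by have := Dx x1; rewrite /D /= -/M -!expr2; lra.
  apply: (der_val (derM (derZ 2 (der_id x1)) (derV (f := fun s => s * s + M * M) q0 q))).
  by rewrite /D -/x1 -/y1 -/M; field; rewrite !expr2.
have Dy (s : R) : m s != 0 -> 0 < D (x1, s).
  move=> ms; rewrite /D /=; have : 0 < m s ^+ 2 by rewrite exprn_even_gt0.
  by nra.
have dD s : der (fun s => x1 * x1 + m s * m s) s (0 + (-1 * m s + m s * -1)).
  by apply: derD; [exact: der_cst|apply: derM; exact: derm].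
have dB3 s : m s != 0 ->
    der (fun s => B (x1, s)) s (- 2 * m s / D (x1, s) - (m s * m s)^-1).
  move=> ms.
  have := @der_comp R (@ln R) (fun s => x1 * x1 + m s * m s) s _ _
    (is_derive1_ln _) (dD s).
  rewrite -!expr2 => /(_ (Dy s ms)) l.
  apply: (der_val (derD (derB l (derV (f := m) ms (derm s))) (der_cst 1 s))).
  have := Dy s ms; rewrite /D /= => ?; field; rewrite ms /=; lra.
have dB4 : der (fun s => - 2 * m s / D (x1, s) - (m s * m s)^-1) y1
    ((2 * D w1 - 4 * M ^+ 2) / D w1 ^+ 2 - 2 / M ^+ 3).
  have q0 : x1 * x1 + M * M != 0 by have := Dx x1; rewrite /D /= -/M -!expr2; lra.
  have M0 : M * M != 0 by rewrite mulf_neq0.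
  apply: (der_val (derB (derM (derZ (-2) (derm y1))
    (derV (f := fun s => x1 * x1 + m s * m s) q0 (dD y1)))
    (derV (f := fun s => m s * m s) M0 (derM (derm y1) (derm y1))))).
  rewrite /D -/x1 -/y1 -/M; field.
  by rewrite m1n0 /= !expr2.
have mn : \forall s \near y1, m s != 0.
  by apply: (cvgr_neq0 _ (der_continuous (derm y1))).
have kE : k w1 = k (x1, y1) by rewrite /x1 /y1 -surjective_pairing.
have c1 : c - e * ((2 * D w1 - 4 * x1 ^+ 2) / D w1 ^+ 2) <= 0.
  apply: (@der_max2 R (fun s => k (s, y1)) (fun s => a s - e * (2 * s / D (s, y1))) x1).
  - by apply: filterS a1 => s a1; exact: (derB a1 (derZ e (dB1 s))).
  - exact: (derB a2 (derZ e dB2)).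
  - by move: hx; rewrite kE.
have c2 : - c - e * ((2 * D w1 - 4 * M ^+ 2) / D w1 ^+ 2 - 2 / M ^+ 3) <= 0.
  apply: (@der_max2 R (fun s => k (x1, s))
    (fun s => b s - e * (- 2 * m s / D (x1, s) - (m s * m s)^-1)) y1).
  - by apply: filterS2 b1 mn => s b1 ms; exact: (derB b1 (derZ e (dB3 s ms))).
  - exact: (derB b2 (derZ e dB4)).
  - by move: hy; rewrite kE.
have D0 : 0 < D w1 by have := D1 _ mw1; lra.
have e1 : (2 * D w1 - 4 * x1 ^+ 2) / D w1 ^+ 2 + (2 * D w1 - 4 * M ^+ 2) / D w1 ^+ 2 = 0.
  rewrite -mulrDl [X in X / _](_ : _ = 0) ?mul0r //.
  by rewrite /D -/x1 -/y1 -/M; ring.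
(* Adding [c1] and [c2] cancels the Laplacians of [h] and of the logarithm and leaves
   [e * (2 / M ^+ 3) <= 0], the contribution of [- 1 / m]. *)
have M3 : 0 < 2 / M ^+ 3 by rewrite divr_gt0 // exprn_gt0 // /M /y1; lra.
by nra.
Qed.

Lemma harmonic_at_cst (k : R) z : harmonic_at (fun=> k) z.
Proof.
exists (fun=> 0), (fun=> 0), 0; rewrite oppr0; split; try exact: der_cst;
  by apply/near_ball; exists 1 => // s _; exact: der_cst.
Qed.

Lemma closed_strip (l r : R) : closed [set z : R * R | l <= z.1 <= r].
Proof.
rewrite (_ : [set z | _] = fst @^-1` `[l, r]%classic).
  by apply: closed_comp; [move=> z _; exact: cvg_fst|exact: itv_closed].
by apply/seteqP; split => z /=; rewrite in_itv.
Qed.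

Lemma strip_nbhs (l r : R) z : l < z.1 < r ->
  nbhs z [set z : R * R | l <= z.1 <= r].
Proof.
move=> /andP[z1 z2].
have h : \forall t \near z.1, l < t /\ t < r.
  by apply: filterI; [exact: lt_nbhsr|exact: lt_nbhsl].
move: h => /near_ball[d d0 hd]; apply/near_box; exists d => // x y hx _ /=.
by have [? ?] := hd x hx; rewrite !ltW.
Qed.

End MaximumPrinciple.

(** * Functions on the fluid domain *)

Section Domain.
Context {R : realType} (eta : R -> R) (ceta : continuous eta).
Implicit Types (f : R * R -> R) (z : R * R).

Lemma fluid_nbhs z : fluid eta z -> nbhs z (fluid eta).
Proof.
rewrite /fluid /= => hz.
have c : {for z, continuous (fun z => eta z.1 - z.2)}.
  apply: cvgB; last exact: cvg_snd.
  by apply: (continuous_comp (g := eta)); [exact: cvg_fst|exact: ceta].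
have : 0 < eta z.1 - z.2 by lra.
by move=> /(cvgr_gt _ c); apply: filterS => w; rewrite subr_gt0.
Qed.

Lemma closed_cl_fluid : closed (cl_fluid eta).
Proof.
rewrite (_ : cl_fluid eta = (fun z => eta z.1 - z.2) @^-1` [set t | 0 <= t]).
  apply: closed_comp; last exact: closed_ge.
  move=> z _; apply: cvgB; last exact: cvg_snd.
  by apply: (continuous_comp (g := eta)); [exact: cvg_fst|exact: ceta].
by apply/seteqP; split => z; rewrite /cl_fluid /= subr_ge0.
Qed.

Lemma fluid_cl z : fluid eta z -> cl_fluid eta z.
Proof. exact: ltW. Qed.

Lemma cl_fluidP z : cl_fluid eta z -> fluid eta z \/ z = surf eta z.1.
Proof.
rewrite /cl_fluid /= le_eqVlt => /orP[/eqP e|]; last by left.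
by right; rewrite /surf -e -surjective_pairing.
Qed.

Lemma fluid_cont f z : {within cl_fluid eta, continuous f} -> fluid eta z ->
  {for z, continuous f}.
Proof.
move=> cf /fluid_nbhs nz; apply: (within_for cf).
by apply: filterS nz => w; exact: fluid_cl.
Qed.

Lemma vertical_within f x a b : {within cl_fluid eta, continuous f} ->
  b <= eta x -> {within `[a, b], continuous (fun s => f (x, s))}.
Proof.
move=> cf bx; apply: (within_comp (k := fun s => (x, s)) cf).
  apply: continuous_subspaceT => s.
  exact: (@continuous_pair R (fun=> x) id s (cvg_cst x) cvg_id).
by move=> s /=; rewrite in_itv /= /cl_fluid /= => /andP[_ sb]; apply: le_trans bx.
Qed.

Lemma surf_within f (A : set R) : {within cl_fluid eta, continuous f} ->
  {within A, continuous (fun s => f (surf eta s))}.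
Proof.
move=> cf; apply: (within_comp (k := surf eta) cf); last first.
  by move=> s _; rewrite /cl_fluid /surf /=.
apply: continuous_subspaceT => s.
exact: (@continuous_pair R id eta s cvg_id (@ceta s)).
Qed.

Lemma eta_above x1 x2 : exists Y, forall s, x1 <= s <= x2 -> Y < eta s.
Proof.
have [x12|x12] := leP x1 x2; last first.
  by exists 0 => s /andP[s1 s2]; have := le_trans s1 s2; rewrite leNgt x12.
have [|m mx hm] := @EVT_min R eta x1 x2 x12 _.
  by apply: continuous_subspaceT.
exists (eta m - 1) => s hs; have := hm s; rewrite in_itv /= hs => /(_ isT).
by lra.
Qed.

(** Two points are joined by descending vertically to a level below the surface over the whole
    interval between their abscissae, then moving horizontally; only the vertical legs touch the
    boundary, where continuity suffices. *)
Lemma grad0_const f : {within cl_fluid eta, continuous f} ->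
  (forall z, fluid eta z -> partials f (fun=> 0) (fun=> 0) z) ->
  forall z1 z2, cl_fluid eta z1 -> cl_fluid eta z2 -> f z1 = f z2.
Proof.
move=> cf df.
have V x y1 y2 : y1 < y2 -> y2 <= eta x -> f (x, y1) = f (x, y2).
  move=> y12 y2x; have hd y : y1 < y < y2 -> der (fun s => f (x, s)) y 0.
    move=> /andP[_ h]; have [] // := df (x, y); rewrite /fluid /=.
    exact: lt_le_trans y2x.
  have [y _ e] := mvt (f' := fun=> 0) y12 hd (vertical_within (a := y1) cf y2x).
  by apply/eqP; rewrite -subr_eq0 -opprB e mul0r oppr0.
have H x1 x2 y : x1 < x2 -> (forall s, x1 <= s <= x2 -> y < eta s) ->
    f (x1, y) = f (x2, y).
  move=> x12 hy; have hd x : x1 <= x <= x2 -> der (fun s => f (s, y)) x 0.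
    by move=> hx; have [] // := df (x, y); exact: hy.
  have hd' x : x1 < x < x2 -> der (fun s => f (s, y)) x 0.
    by move=> /andP[? ?]; apply: hd; rewrite !ltW.
  have [x _ e] := mvt (f' := fun=> 0) x12 hd' (der_within (f' := fun=> 0) hd).
  by apply/eqP; rewrite -subr_eq0 -opprB e mul0r oppr0.
suff W z1 z2 : cl_fluid eta z1 -> cl_fluid eta z2 -> z1.1 <= z2.1 -> f z1 = f z2.
  by move=> z1 z2 h1 h2; case: (leP z1.1 z2.1) => [|/ltW] h; [|apply/esym]; exact: W.
case: z1 z2 => [x1 y1] [x2 y2] /= h1 h2 x12.
have [Y hY] := eta_above x1 x2.
pose y := Num.min Y (Num.min y1 y2) - 1.
have [yY yy1 yy2] : [/\ y < Y, y < y1 & y < y2].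
  by rewrite /y; split; rewrite ltrBlDr !gt_min !ltrDl ltr01 ?orbT.
rewrite -(V _ _ _ yy1 h1) -(V _ _ _ yy2 h2).
move: x12; rewrite le_eqVlt => /predU1P[->//|x12].
by apply: H => // s /hY; exact: lt_trans.
Qed.

Lemma below_surf_cvg f (A : set (R * R)) x (l : R) :
  f @ within A (nbhs (surf eta x)) --> l ->
  (forall t, 0 < t -> A (x, eta x - t)) -> f (x, eta x - t) @[t --> 0^'+] --> l.
Proof.
move=> hl hA B /hl nB.
have : \forall t \near (0 : R), 0 < t -> B (f (x, eta x - t)).
  move: nB => /near_box[d d0 hd]; apply/near_ball; exists d => // t td t0.
  apply: hd; rewrite /=.
  - by rewrite subrr normr0.
  - by rewrite addrAC subrr sub0r normrN; move: td; rewrite subr0.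
  - exact: hA.
by [].
Qed.

(* a + i b is complex differentiable, with derivative a' + i b'. *)
Definition holo (a b a' b' : R * R -> R) := forall z, fluid eta z ->
  C1 a a' (fun w => - b' w) z /\ C1 b b' a' z.

Lemma holo_partials a b a' b' z : holo a b a' b' -> fluid eta z ->
  partials a a' (fun w => - b' w) z /\ partials b b' a' z.
Proof. by move=> h /h[[/nbhs_singleton h1 _ _] [/nbhs_singleton h2 _ _]]. Qed.

Lemma holo_intro a b a' b' :
  (forall z, fluid eta z ->
    partials a a' (fun w => - b' w) z /\ partials b b' a' z) ->
  (forall z, fluid eta z -> {for z, continuous a'}) ->
  (forall z, fluid eta z -> {for z, continuous b'}) -> holo a b a' b'.
Proof.
move=> h ca cb z hz; have nz := fluid_nbhs hz; split; split; try exact: ca;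
  try exact: cb.
- by apply: filterS nz => w /h[].
- by apply: cvgN; exact: cb.
- by apply: filterS nz => w /h[].
Qed.

Lemma holo_cont a b a' b' z : holo a b a' b' -> fluid eta z ->
  {for z, continuous a} /\ {for z, continuous b}.
Proof.
move=> h /h[/C1_caratheodory[A [B [fE cA cB _ _]]]].
move=> /C1_caratheodory[C [D [fE' cC cD _ _]]].
have H f A' B' : (forall z', f z' - f z = A' z' * (z'.1 - z.1) + B' z' * (z'.2 - z.2)) ->
    {for z, continuous A'} -> {for z, continuous B'} -> {for z, continuous f}.
  move=> fE0 cA' cB'.
  rewrite (_ : f = fun z' => f z + (A' z' * (z'.1 - z.1) + B' z' * (z'.2 - z.2))).
    apply: cvgD; first exact: cvg_cst.
    apply: cvgD; apply: cvgM => //; (apply: cvgB; last exact: cvg_cst).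
      exact: cvg_fst.
    exact: cvg_snd.
  by apply/funext => w; rewrite -fE0 addrC subrK.
by split; [exact: H fE cA cB|exact: H fE' cC cD].
Qed.

(** Cauchy-Riemann used twice gives a_xx = [a2] and a_yy = [- a2] directly, with no exchange of
    mixed derivatives. *)
Lemma holo_harmonic a b a' b' a2 b2 z : holo a b a' b' -> holo a' b' a2 b2 ->
  fluid eta z -> harmonic_at a z /\ harmonic_at b z.
Proof.
move=> h1 h2 hz; have nz := fluid_nbhs hz.
have nx : \forall s \near z.1, fluid eta (s, z.2).
  move/near_box : nz => [d d0 hd]; apply/near_ball; exists d => // s sd.
  by apply: hd => //; rewrite subrr normr0.
have ny : \forall s \near z.2, fluid eta (z.1, s).
  move/near_box : nz => [d d0 hd]; apply/near_ball; exists d => // s sd.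
  by apply: hd => //; rewrite subrr normr0.
split.
  exists (fun s => a' (s, z.2)), (fun s => - b' (z.1, s)), (a2 z); split.
  - by apply: filterS nx => s /(holo_partials h1)[[]].
  - by have [[]] := holo_partials h2 hz.
  - by apply: filterS ny => s /(holo_partials h1)[[]].
  - by apply: derN; have [_ []] := holo_partials h2 hz.
exists (fun s => b' (s, z.2)), (fun s => a' (z.1, s)), (b2 z); split.
- by apply: filterS nx => s /(holo_partials h1)[_ []].
- by have [_ []] := holo_partials h2 hz.
- by apply: filterS ny => s /(holo_partials h1)[_ []].
- by have [[]] := holo_partials h2 hz.
Qed.

Lemma continuous_within_bounded f (A : set (R * R)) : compact A ->
  {within A, continuous f} -> exists K, forall z, A z -> `|f z| <= K.
Proof.
move=> cA cf; have [->|/set0P A0] := eqVneq A set0; first by exists 0.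
have cn : {within A, continuous (fun z => `|f z|)}.
  by move=> x; apply: cvg_norm; exact: cf.
have [m _ hm] := compact_EVT_max A0 cA cn.
by exists `|f m| => z Az; apply: hm; rewrite inE.
Qed.

End Domain.

(** * Periodic and quasiperiodic functions of one variable *)

Section Periodicity.
Context {R : realType}.

Lemma pi2_gt0 : 0 < 2 * pi :> R.
Proof. by rewrite mulr_gt0 // pi_gt0. Qed.

Lemma periodic_int (T : Type) (f : R -> T) (p : R) : (forall x, f (x + p) = f x) ->
  forall (m : int) x, f (x + p * m%:~R) = f x.
Proof.
move=> hf; have N (n : nat) x : f (x + p * n%:R) = f x.
  elim: n x => [|n IH] x; first by rewrite mulr0 addr0.
  by rewrite -addn1 natrD mulrDr mulr1 addrA hf.
case=> n x; first exact: N.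
by rewrite NegzE -[in RHS](subrK (p * n.+1%:R) x) N mulrNz mulrN.
Qed.

Lemma mod_period (p x : R) : 0 < p ->
  exists m : int, 0 <= x + p * m%:~R < p.
Proof.
move=> p0; exists (- Num.floor (x / p)); rewrite mulrNz mulrN.
have := floor_itv (x / p); rewrite -?in_itv /= intrD => /andP[h1 h2].
have h3 : (Num.floor (x / p))%:~R * p <= x by rewrite -ler_pdivlMr.
have h4 : x < ((Num.floor (x / p))%:~R + 1) * p by rewrite -ltr_pdivrMr.
by apply/andP; split; nra.
Qed.

Lemma quasiperiodic_int (f : R -> R) (p C : R) : (forall x, f (x + p) = f x + C) ->
  forall (m : int) x, f (x + p * m%:~R) = f x + C * m%:~R.
Proof.
move=> hf; have N (n : nat) x : f (x + p * n%:R) = f x + C * n%:R.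
  elim: n x => [|n IH] x; first by rewrite !mulr0 !addr0.
  by rewrite -addn1 natrD !mulrDr !mulr1 !addrA hf IH.
case=> n x; first exact: N.
have := N n.+1 (x + p * (Negz n)%:~R); rewrite NegzE mulrNz !mulrN subrK => ->.
by rewrite addrK.
Qed.

(** Carries monotonicity across crests, where no derivative is available. After shifting [x] into
    the first period, [- k] counts the periods between it and [y]: for [k = 0] both points lie in
    one period, otherwise the comparison passes through the value [f 0 + C] at its end, using
    [0 <= C]. *)
Lemma quasiperiodic_nondecreasing (f : R -> R) (p C : R) : 0 < p ->
  (forall x, f (x + p) = f x + C) ->
  (forall x y, 0 <= x -> x <= y -> y <= p -> f x <= f y) ->
  forall x y, x <= y -> f x <= f y.
Proof.
move=> p0 hf hm x y xy.
have [m /andP[x0 xp]] := mod_period x p0.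
have C0 : 0 <= C.
  by have := hm 0 p (lexx _) (ltW p0) (lexx _); have := hf 0; rewrite add0r => ->; lra.
have [k /andP[y0 yp]] := mod_period (y + p * m%:~R) p0.
set x' := x + _ in x0 xp *; set y' := y + _ in y0 yp *.
set y2 := y' + _ in y0 yp *.
have fx : f x' = f x + C * m%:~R by exact: quasiperiodic_int.
have fy : f y2 = f y + C * m%:~R + C * k%:~R.
  by rewrite /y2 !(quasiperiodic_int hf).
have xy' : x' <= y' by rewrite lerD2r.
suff : f x' <= f y2 - C * k%:~R by rewrite fx fy; lra.
have k1 : k <= 0.
  have : p * k%:~R < p * 1 by rewrite mulr1; move: yp; rewrite /y2; lra.
  by rewrite ltr_pM2l // -[1]/(1%:~R) ltr_int; lia.
move: k1; rewrite le_eqVlt => /orP[/eqP k0|k1].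
  have y2E : y2 = y' by rewrite /y2 k0 mulr0 addr0.
  by rewrite k0 mulr0 subr0 y2E; apply: hm => //; rewrite -y2E ltW.
have k1' : (k%:~R : R) <= -1 by rewrite -[-1]/((-1)%:~R) ler_int; lia.
have h1 : f x' <= f 0 + C by rewrite -hf add0r; apply: hm => //; exact: ltW.
have h2 : f 0 <= f y2 by apply: hm => //; exact: ltW.
by have := ler_wpM2l C0 k1'; lra.
Qed.

(** Such an [f] is a nondecreasing function of the distance to the multiples of [L], and reflecting
    [x] in [l] does not increase this distance: [|2 * l - x|] is at most [x] because [0 <= l <= x],
    and at most [L - x] because [l <= L / 2] and [x <= l + L / 2]. *)
Lemma reflect_le (f : R -> R) (L : R) : (forall x, f (- x) = f x) ->
  (forall x, f (x + L) = f x) ->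
  (forall x y, 0 <= x -> x <= y -> y <= L / 2 -> f x <= f y) ->
  forall l x, 0 <= l -> l <= L / 2 -> l <= x -> x <= l + L / 2 ->
  f (2 * l - x) <= f x.
Proof.
move=> fN fL fm l x l0 lL lx xL.
have fA y : f `|y| = f y by case: (ger0P y).
rewrite -(fA (2 * l - x)).
have [xh|xh] := leP x (L / 2).
  by apply: fm => //; rewrite ler_norml; lra.
have -> : f x = f (L - x) by rewrite -(fN x) -(fL (- x)) addrC.
by apply: fm => //; [rewrite ler_norml; lra|lra].
Qed.

Lemma crest0 : crest (0 : R).
Proof. by exists 0; rewrite mulr0. Qed.

Lemma not_crest x : 0 < x < 2 * pi -> ~ crest (x : R).
Proof.
move=> /andP[x0 x1] [m xm]; have p0 := pi2_gt0.
move: x0 x1; rewrite xm pmulr_rgt0 // gtr_pMr // ltr0z -[1]/(1%:~R) ltr_int.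
by lia.
Qed.

Lemma der_unique (f f' : R -> R) (x a b : R) : (\forall s \near x, f s = f' s) ->
  der f x a -> der f' x b -> a = b.
Proof. by move=> /der_near h /h[_ <-] [_ <-]. Qed.

End Periodicity.

(** * The complex velocity F and Euler's equations *)

Section Wave.
Context {R : realType} (g c P0 : R) (eta : R -> R) (u v P : R * R -> R).
Context (hg : 0 < g) (hc : 0 < c).
Context (hw : extreme_stokes_wave g c P0 eta u v P).

Let hs := esw_stokes hw.
Let hww := sw_wave hs.
Let rho (z : R * R) := c - u z.

Lemma wave_eta_cont : continuous eta. Proof. exact: ww_eta_cont hww. Qed.
Let ceta := wave_eta_cont.

Lemma rho_cont : {within cl_fluid eta, continuous rho}.
Proof. by move=> x; apply: cvgB; [exact: cvg_cst|exact: (ww_u_cont hww)]. Qed.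

Lemma smooth_jet f : smooth_upto crest eta f ->
  exists F : nat -> nat -> R * R -> R,
    [/\ forall i j, {within reg_fluid crest eta, continuous (F i j)},
      forall i j z, fluid eta z -> {for z, continuous (F i j)},
      forall i j z, fluid eta z -> partials (F i j) (F i.+1 j) (F i j.+1) z &
      forall z, fluid eta z -> [/\ partials f (F 1 0)%N (F 0 1)%N z,
        'D_ex f z = F 1%N 0%N z & 'D_ey f z = F 0%N 1%N z]].
Proof.
move=> [F [F0 hF]]; exists F.
have fr z : fluid eta z -> reg_fluid crest eta z by left.
have nr z : fluid eta z -> nbhs z (reg_fluid crest eta).
  by move=> /(fluid_nbhs ceta); apply: filterS.
have pF i j z : fluid eta z -> partials (F i j) (F i.+1 j) (F i j.+1) z.
  move=> hz; have [_ /(_ _ hz)[h1 h2]] := hF i j.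
  by split; [exact: is_derive_exE|exact: is_derive_eyE].
split => //.
- by move=> i j; have [] := hF i j.
- by move=> i j z hz; have [cF _] := hF i j; apply: (within_for cF); exact: nr.
- move=> z hz; have e : \near z, F 0%N 0%N z = f z.
    by apply: filterS (nr _ hz) => w; exact: F0.
  have [_ /(_ _ hz)[h1 h2]] := hF 0%N 0%N.
  have k1 := near_eq_is_derive e h1; have k2 := near_eq_is_derive e h2.
  split; [split; [exact: is_derive_exE k1|exact: is_derive_eyE k2]| |].
    by have [_ ->] := k1.
  by have [_ ->] := k2.
Qed.

(** Here [al + i be] is F' and [al2 + i be2] is F''. The Cauchy-Riemann equations of F are
    incompressibility and irrotationality; those of F' follow by differentiating these two
    identities in x alone, since equality of mixed derivatives is built into the double indexing of
    the jets. *)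
Lemma flow_jets : exists al be al2 be2 : R * R -> R,
  [/\ holo eta rho v al be, holo eta al be al2 be2 &
      forall z, fluid eta z -> 'D_ey P z = - g + (rho z * be z - v z * al z) /\
        partials P (fun w => - (rho w * al w + v w * be w))
          (fun w => - g + (rho w * be w - v w * al w)) z].
Proof.
have [U [_ cU pU hU]] := smooth_jet (ww_u_smooth hww).
have [V [_ cV pV hV]] := smooth_jet (ww_v_smooth hww).
have [Q [_ cQ pQ hQ]] := smooth_jet (ww_P_smooth hww).
have e1 z : fluid eta z -> V 0 1 z = - U 1 0 z.
  move=> hz; have := ww_incompressible hww hz.
  by have [_ -> _] := hU z hz; have [_ _ ->] := hV z hz; lra.
have e2 z : fluid eta z -> U 0 1 z = V 1 0 z.
  move=> hz; have := ww_irrotational hww hz.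
  by have [_ _ ->] := hU z hz; have [_ -> _] := hV z hz; lra.
have nx z : fluid eta z -> \forall s \near z.1, fluid eta (s, z.2).
  move=> /(fluid_nbhs ceta)/near_box[d d0 hd]; apply/near_ball; exists d => // s sd.
  by apply: hd => //; rewrite subrr normr0.
have e3 z : fluid eta z -> U 1 1 z = V 2 0 z.
  move=> hz; apply: (@der_unique R (fun s => U 0 1 (s, z.2)) (fun s => V 1 0 (s, z.2)) z.1)%N.
  - by apply: filterS (nx _ hz) => s /e2.
  - by have [] := pU 0%N 1%N z hz.
  - by have [] := pV 1%N 0%N z hz.
have e4 z : fluid eta z -> V 1 1 z = - U 2 0 z.
  move=> hz; apply: (@der_unique R (fun s => V 0 1 (s, z.2)) (fun s => - U 1 0 (s, z.2)) z.1)%N.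
  - by apply: filterS (nx _ hz) => s /e1.
  - by have [] := pV 0%N 1%N z hz.
  - by apply: derN; have [] := pU 1%N 0%N z hz.
exists (fun z => - U 1%N 0%N z), (V 1%N 0%N), (fun z => - U 2 0 z)%N, (V 2 0)%N; split.
- apply: holo_intro => // [z hz|z hz|z hz].
  + have [[h1 h2] _ _] := hU z hz; have [[k1 k2] _ _] := hV z hz.
    split; split.
    * by have := derB (der_cst c z.1) h1; rewrite sub0r.
    * by have := derB (der_cst c z.2) h2; rewrite sub0r e2.
    * exact: k1.
    * by rewrite -e1.
  + by apply: cvgN; exact: cU.
  + exact: cV.
- apply: holo_intro => // [z hz|z hz|z hz].
  + have [h1 h2] := pU 1%N 0%N z hz; have [k1 k2] := pV 1%N 0%N z hz.
    split; split.
    * exact: derN.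
    * by rewrite -e3 //; exact: derN.
    * exact: k1.
    * by rewrite -e4.
  + by apply: cvgN; exact: cU.
  + exact: cV.
- move=> z hz.
  have [_ ux uy] := hU z hz; have [_ vx vy] := hV z hz.
  have [[p1 p2] px py] := hQ z hz.
  have E1 := ww_euler_x hww hz; have E2 := ww_euler_y hww hz.
  have x1 : Q 1 0 z = - (rho z * - U 1 0 z + v z * V 1 0 z).
    by move: E1; rewrite ux uy px e2 // /rho; nra.
  have x2 : Q 0 1 z = - g + (rho z * V 1 0 z - v z * - U 1 0 z).
    by move: E2; rewrite vx vy py e1 // /rho; nra.
  split; first by rewrite py x2.
  by split; rewrite -?x1 -?x2.
Qed.

End Wave.

(** * The free surface *)

Section Surface.
Context {R : realType} (g c P0 : R) (eta : R -> R) (u v P : R * R -> R).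
Context (hg : 0 < g) (hc : 0 < c).
Context (hw : extreme_stokes_wave g c P0 eta u v P).

Let hs := esw_stokes hw.
Let hww := sw_wave hs.
Let rho (z : R * R) := c - u z.
Let ceta : continuous eta := wave_eta_cont hw.
Let s : R -> R := derive1 eta.

(** Euler's equations make the gradient of [B] vanish; the constant is evaluated at the crest, where
    the relative velocity is zero, and [P0] cancels. *)
Lemma bernoulli_surf x :
  rho (surf eta x) ^+ 2 + v (surf eta x) ^+ 2 = 2 * g * (eta 0 - eta x).
Proof.
have [al [be [al2 [be2 [h1 _ h3]]]]] := flow_jets hw.
pose B (z : R * R) := P z + (rho z * rho z + v z * v z) / 2 + g * z.2.
have cB : {within cl_fluid eta, continuous B}.
  move=> z; apply: cvgD; first apply: cvgD.
  - exact: (ww_P_cont hww).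
  - apply: cvgM; last exact: cvg_cst.
    apply: cvgD; apply: cvgM; try exact: (rho_cont hw); exact: (ww_v_cont hww).
  - apply: cvgM; first exact: cvg_cst.
    by move: z; apply: continuous_subspaceT => z; exact: cvg_snd.
have dB z : fluid eta z -> partials B (fun=> 0) (fun=> 0) z.
  move=> hz; have [[r1 r2] [v1 v2]] := holo_partials h1 hz.
  have [_ [p1 p2]] := h3 z hz.
  split.
    apply: (der_val (derD (derD p1 (derM (derD (derM r1 r1) (derM v1 v1))
      (der_cst 2^-1 z.1))) (der_cst (g * z.2) z.1))).
    by rewrite -surjective_pairing; field.
  apply: (der_val (derD (derD p2 (derM (derD (derM r2 r2) (derM v2 v2))
    (der_cst 2^-1 z.2))) (derZ g (der_id z.2)))).
  by rewrite -surjective_pairing; field.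
have scl t : cl_fluid eta (surf eta t) by rewrite /cl_fluid /surf /=.
have := grad0_const ceta cB dB (scl x) (scl 0).
have [u0 v0] := esw_stagnation hw (@crest0 R).
rewrite /B !(ww_dynamic hww) /rho u0 v0 /=.
by lra.
Qed.

(** The squared speed in Bernoulli's law is nonnegative. *)
Lemma eta_le0 x : eta x <= eta 0.
Proof.
have g2 : 0 < 2 * g by have := hg; lra.
rewrite -subr_ge0 -(pmulr_rge0 _ g2) -bernoulli_surf.
by rewrite addr_ge0 ?sqr_ge0.
Qed.

Lemma eta_per (m : int) x : eta (x + 2 * pi * m%:~R) = eta x.
Proof. exact: (periodic_int (sw_eta_per hs)). Qed.

Lemma field_per (f : R * R -> R) : periodic_in_x eta f ->
  forall (m : int) x y, y <= eta x -> f (x + 2 * pi * m%:~R, y) = f (x, y).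
Proof.
(* Setting the value to 0 above the surface makes [h] periodic at every abscissa, as [periodic_int]
   requires. *)
move=> hf m x y hy; pose h t := if y <= eta t then f (t, y) else 0.
have := @periodic_int R R h (2 * pi) _ m x.
rewrite /h eta_per hy; apply => t.
by rewrite (sw_eta_per hs); case: ifP => // ht; exact: (hf (t, y)).
Qed.

Lemma deep_bound : exists Y, (forall x, Y < eta x) /\
  forall x y, y <= Y -> `|u (x, y)| < c / 2.
Proof.
have c2 : 0 < c / 2 by have := hc; lra.
have [Y0 [_ hY]] := ww_deep hww c2.
have [Y1 hY1] := eta_above ceta 0 (2 * pi).
exists (Num.min Y1 (Y0 - 1)); split=> [x|x y].
  have [m hm] := mod_period x (@pi2_gt0 R).
  rewrite -(eta_per m) gt_min hY1 //.
  by case/andP: hm => -> /ltW.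
rewrite le_min => /andP[_ y0].
by have [] := hY y _ x => //; lra.
Qed.

(** One period above a fixed level is compact, and below that level the decay at depth applies. This
    supplies the upper bounds needed by the maximum principle. *)
Lemma flow_bounded : exists K, forall z, cl_fluid eta z ->
  `|rho z| <= K /\ `|v z| <= K.
Proof.
have c1 : 0 < (1 : R) by [].
have [Y [_ hY]] := ww_deep hww c1.
pose A : set (R * R) :=
  (`[0, 2 * pi]%classic `*` `[Y - 1, eta 0]%classic) `&` cl_fluid eta.
have cA : compact A.
  apply: compact_closedI; last exact: closed_cl_fluid.
  by apply: compact_setX; exact: segment_compact.
have [K1 hK1] := continuous_within_bounded cA
  (continuous_subspaceW (@subIsetr _ _ (cl_fluid eta)) (rho_cont hw)).
have [K2 hK2] := continuous_within_bounded cA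
  (continuous_subspaceW (@subIsetr _ _ (cl_fluid eta)) (ww_v_cont hww)).
exists (Num.max (c + 1) (Num.max K1 K2)) => -[x y] hz.
rewrite !le_max; have [y1|y1] := ltP y Y.
  have [ux vx] := hY y y1 x.
  have k1 : `|rho (x, y)| <= c + 1.
    by have := hc; move: ux; rewrite /rho ltr_norml ler_norml => /andP[? ?] ?; lra.
  by rewrite k1; split => //; apply/orP; left; have := hc; lra.
have [m /andP[m0 m1]] := mod_period x (@pi2_gt0 R).
have hA : A (x + 2 * pi * m%:~R, y).
  split; last by rewrite /cl_fluid /= eta_per.
  split => /=; rewrite in_itv /=; first by rewrite m0 ltW.
  by apply/andP; split; [lra|apply: le_trans hz _; exact: eta_le0].
have e1 : rho (x + 2 * pi * m%:~R, y) = rho (x, y).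
  by rewrite /rho (field_per (sw_u_per hs)).
have e2 : v (x + 2 * pi * m%:~R, y) = v (x, y).
  exact: (field_per (sw_v_per hs)).
have k1 : `|rho (x + 2 * pi * m%:~R, y)| <= K1 := hK1 _ hA.
have := hK2 _ hA; rewrite e2 => ->; rewrite e1 in k1; rewrite k1.
by rewrite !orbT.
Qed.

Lemma surf_speed_gt0 x : ~ crest x -> 0 < rho (surf eta x).
Proof.
move=> hx; have := esw_u_lt hw (z := surf eta x).
by rewrite /rho subr_gt0; apply; right.
Qed.

Lemma fluid_speed_gt0 z : fluid eta z -> 0 < rho z.
Proof. by move=> hz; rewrite /rho subr_gt0; apply: (esw_u_lt hw); left. Qed.

Lemma surf_v x : ~ crest x -> v (surf eta x) = - (rho (surf eta x) * s x).
Proof. by move=> hx; rewrite (ww_kinematic hww hx) /rho; rewrite -mulNr opprB. Qed.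

Lemma der_eta x : ~ crest x -> der eta x (s x).
Proof.
move=> hx; have /derivableP := @ww_eta_smooth _ _ _ _ _ _ _ _ _ hww 0%N x hx.
by rewrite /s derive1E.
Qed.

Lemma der_slope x : ~ crest x -> der s x (derive1 s x).
Proof.
move=> hx; have /derivableP := @ww_eta_smooth _ _ _ _ _ _ _ _ _ hww 1%N x hx.
by rewrite derive1E.
Qed.

Lemma eta_convex_below x y : 0 <= x <= 2 * pi -> 0 <= y <= 2 * pi ->
  forall t, 0 <= t <= 1 -> eta (x + t * (y - x)) <= eta x + t * (eta y - eta x).
Proof.
move=> hx hy t /andP[t0 t1].
pose T : {i01 R} := Itv01 t0 t1.
have := esw_convex hw T (x := y) (y := x).
rewrite !inE /= !in_itv /= => /(_ hy hx).
have -> : x + t * (y - x) = t * y + (1 - t) * x by ring.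
by move=> h; apply: (le_trans h); rewrite convRE /unstable.onem /=; lra.
Qed.

(** The derivative is the limit of slopes over short chords, and by convexity these rise no more
    steeply than the full chord. Since [y] may be a crest abscissa, the slope inside the period can
    be compared with chords drawn from the corner. *)
Lemma slope_chord (x y d : R) : 0 <= x <= 2 * pi -> 0 <= y <= 2 * pi ->
  der eta x d -> d * (y - x) <= eta y - eta x.
Proof.
move=> hx hy dx; rewrite leNgt; apply/negP => hlt.
have yx : y - x != 0.
  by apply: contraTneq hlt => /eqP; rewrite subr_eq0 => /eqP ->; rewrite !subrr mulr0 ltxx.
have h : der (fun t => eta ((y - x) * t + x)) 0 ((y - x) * d).
  by apply: (der_affine (u := eta)); rewrite mulr0 add0r.
have /is_derive1_caratheodory[k [kE ck k0]] := h.
have : \forall t \near 0, eta y - eta x < k t.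
  by apply: (cvgr_gt _ ck); rewrite k0 mulrC.
move=> /near_ball[e e0 he].
pose t := Num.min (e / 2) 1.
have t0 : 0 < t by rewrite lt_min ltr01 divr_gt0.
have t1 : t <= 1 by rewrite ge_min lexx orbT.
have te : `|t - 0| < e.
  by rewrite subr0 gtr0_norm // gt_min; apply/orP; left; lra.
have h1 : eta (x + t * (y - x)) - eta x = k t * t.
  by have := kE t; rewrite mulr0 add0r subr0 [x + _]addrC [t * _]mulrC.
have h2 : eta (x + t * (y - x)) <= eta x + t * (eta y - eta x).
  by apply: eta_convex_below => //; rewrite (ltW t0).
have h3 : eta y - eta x < k t by exact: he.
by nra.
Qed.

Lemma eta_even x : eta (- x) = eta x. Proof. exact: (sw_eta_even hs). Qed.

(** Evenness forces [sl = - sr], so the contained angle is [pi + 2 * atan sr] and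
    [atan sr = - (pi / 6)]. The triple-angle formula for the cosine then yields [3 * sr ^+ 2 = 1]
    without evaluating a tangent. *)
Lemma corner_slope : exists r : R,
  [/\ 0 <= r, 3 * r ^+ 2 = 1 & (eta t - eta 0) / t @[t --> 0^'+] --> - r].
Proof.
have [sl [sr []]] := esw_corner hw (@crest0 R).
rewrite [X in X @ _ --> sl](_ : _ = fun t => (eta t - eta 0) / t); last first.
  by apply/funext => t; rewrite add0r.
rewrite [X in X @ _ --> sr](_ : _ = fun t => (eta t - eta 0) / t); last first.
  by apply/funext => t; rewrite add0r.
move=> hl hr hth.
have hr' : (eta t - eta 0) / t @[t --> 0^'+] --> - sl.
  have : (eta (- t) - eta 0) / (- t) @[t --> 0^'+] --> sl.
    by have := (cvg_at_leftNP (fun t => (eta t - eta 0) / t) 0 sl).1 hl; rewrite oppr0.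
  move=> h; rewrite (_ : (fun t => _) = fun t => - ((eta (- t) - eta 0) / (- t))).
    exact: cvgN h.
  by apply/funext => t; rewrite eta_even invrN mulrN opprK.
have srE : sr = - sl by apply: cvg_unique hr hr'; exact: Rhausdorff.
exists (- sr); split; rewrite ?opprK //.
- rewrite oppr_ge0 leNgt; apply/negP => sr0.
  have := lt_atan sr0; rewrite atan0.
  by move: hth; rewrite srE atanN; have := @pi_gt0 R; lra.
- have th : atan sr = - (pi / 6).
    by move: hth; rewrite srE !atanN; lra.
  have c0 : cos (3 * atan sr) = 0.
    by rewrite th (_ : 3 * _ = - (pi / 2)) ?cosN ?cos_pihalf //; field.
  have c3 : cos (3 * atan sr) = cos (atan sr) * (4 * cos (atan sr) ^+ 2 - 3).
    rewrite (_ : 3 * atan sr = atan sr + (atan sr + atan sr)); last by ring.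
    rewrite cosD cosD sinD.
    have := cos2Dsin2 (atan sr).
    move: (cos _) (sin _) => co si h; have si2 : si ^+ 2 = 1 - co ^+ 2 by lra.
    by transitivity (co * (co ^+ 2 - 3 * si ^+ 2)); [ring|rewrite si2; ring].
  have cs : cos (atan sr) ^+ 2 = (1 + sr ^+ 2)^-1.
    by rewrite cos_atan exprVn sqr_sqrtr // addr_ge0 ?sqr_ge0.
  have cn : cos (atan sr) != 0.
    rewrite cos_atan invr_neq0 // sqrtr_eq0 -ltNge.
    by have := sqr_ge0 sr; lra.
  move: c3; rewrite c0 cs => /esym/eqP.
  rewrite mulf_eq0 (negbTE cn) /= subr_eq0 => /eqP h.
  have s0 : 1 + sr ^+ 2 != 0 by have := sqr_ge0 sr; lra.
  have : 4 = 3 * (1 + sr ^+ 2) by rewrite -h mulrVK ?unitfE.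
  by rewrite sqrrN; lra.
Qed.

Let ncr x : 0 < x < 2 * pi -> ~ crest (x : R). Proof. exact: not_crest. Qed.

Lemma slope_mono x y : 0 < x -> x <= y -> y < 2 * pi -> s x <= s y.
Proof.
rewrite le_eqVlt => x0 /predU1P[->//|xy] y1.
have hx : 0 < x < 2 * pi by rewrite x0 (lt_trans xy).
have hy : 0 < y < 2 * pi by rewrite y1 (lt_trans x0).
have hx' : 0 <= x <= 2 * pi by case/andP: hx => ? ?; rewrite !ltW.
have hy' : 0 <= y <= 2 * pi by case/andP: hy => ? ?; rewrite !ltW.
have := slope_chord hx' hy' (der_eta (ncr hx)).
have := slope_chord hy' hx' (der_eta (ncr hy)).
by nra.
Qed.

Lemma slope_sym x : 0 < x < 2 * pi -> s (2 * pi - x) = - s x.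
Proof.
move=> /andP[x0 x1].
have h : 0 < 2 * pi - x < 2 * pi by apply/andP; split; move: x0 x1; move: (2 * pi) => p; lra.
have d1 := der_eta (ncr h).
have d2 : der (fun t => eta (-1 * t + 2 * pi)) x (-1 * s (2 * pi - x)).
  by apply: (der_affine (u := eta)); rewrite mulN1r addrC.
have hx : 0 < x < 2 * pi by rewrite x0.
have := der_unique _ d2 (der_eta (ncr hx)).
rewrite mulN1r => <-; first by rewrite opprK.
by near=> t; rewrite mulN1r (sw_eta_per hs) eta_even.
Unshelve. all: by end_near. Qed.

Lemma slope_le0 x : 0 < x -> x <= pi -> s x <= 0.
Proof.
move=> x0 x1; have p0 := @pi_gt0 R.
have hp : 0 < (pi : R) < 2 * pi by apply/andP; split; move: p0; move: pi => p; lra.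
have := slope_mono x0 x1; have := slope_sym hp.
have -> : 2 * pi - pi = pi :> R by move: pi => p; ring.
by case/andP: hp => _ hp e /(_ hp); lra.
Qed.

Lemma eta_decr x y : 0 <= x -> x <= y -> y <= pi -> eta y <= eta x.
Proof.
move=> x0; rewrite le_eqVlt => /predU1P[->//|xy] ypi.
have y0 : 0 < y by apply: le_lt_trans xy.
have y2 : y < 2 * pi by have := @pi_gt0 R; move: ypi; move: pi => t; lra.
have hy : 0 < y < 2 * pi by rewrite y0.
have hx' : 0 <= x <= 2 * pi by rewrite x0 ltW // (lt_trans xy).
have hy' : 0 <= y <= 2 * pi by rewrite !ltW.
have := slope_chord hy' hx' (der_eta (ncr hy)).
by have := slope_le0 y0 ypi; nra.
Qed.

(** By convexity the corner slope is extreme: the chord from the crest to [t] has slope at most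
    [s t <= s y], and these chord slopes tend to [- r]. Symmetry about the trough gives the bound on
    the other side. *)
Lemma slope_bound x : 0 < x < 2 * pi -> 3 * s x ^+ 2 <= 1.
Proof.
have [r [r0 r3 hr]] := corner_slope.
have L y : 0 < y < 2 * pi -> - r <= s y.
  move=> /andP[y0 y1]; apply: (cvgr_to_le hr).
  near=> t.
  have t0 : 0 < t by near: t; exact: nbhs_right_gt.
  have ty : t < y by near: t; exact: nbhs_right_lt.
  have ht : 0 < t < 2 * pi by rewrite t0 (lt_trans ty).
  have ht' : 0 <= t <= 2 * pi by case/andP: ht => ? ?; rewrite !ltW.
  have h0 : 0 <= (0 : R) <= 2 * pi by rewrite lexx ltW // pi2_gt0.
  apply: le_trans (slope_mono t0 (ltW ty) y1).
  have := slope_chord ht' h0 (der_eta (ncr ht)).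
  by rewrite sub0r ler_pdivrMr //; lra.
move=> hx; have h1 := L _ hx.
have h2 : - r <= s (2 * pi - x).
  by apply: L; case/andP: hx; move: (2 * pi) => p ? ?; apply/andP; lra.
by move: h2; rewrite slope_sym //; nra.
Unshelve. all: by end_near. Qed.

Lemma slope_der_ge0 x : 0 < x < 2 * pi -> 0 <= derive1 s x.
Proof.
move=> hx; rewrite leNgt; apply/negP => h.
have /is_derive1_caratheodory[k [kE ck k0]] := der_slope (ncr hx).
have hk : \forall t \near x, k t < 0 by apply: (cvgr_lt _ ck); rewrite k0.
have hp : \forall t \near x, t < 2 * pi.
  by apply: lt_nbhsl; case/andP: hx.
have [d d0 hd] := (near_ball x (fun t => k t < 0 /\ t < 2 * pi)).1 (filterI hk hp).
have [|k1 k2] := hd (x + d / 2).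
  by rewrite [x + _]addrC addrK gtr0_norm; lra.
have := @slope_mono x (x + d / 2); case/andP: hx => -> _ /(_ isT).
have -> : x <= x + d / 2 by lra.
move=> /(_ isT k2); rewrite -subr_ge0 kE; nra.
Qed.

Let r x := rho (surf eta x).

Lemma surf_bernoulli x : ~ crest x ->
  r x ^+ 2 * (1 + s x ^+ 2) = 2 * g * (eta 0 - eta x).
Proof. by move=> hx; rewrite -bernoulli_surf surf_v // -/(r x); ring. Qed.

(* Real and imaginary parts of F^3, where F = (c - u) + i v. *)
Definition cube_re (z : R * R) := rho z ^+ 3 - 3 * rho z * v z ^+ 2.
Definition cube_im (z : R * R) := 3 * rho z ^+ 2 * v z - v z ^+ 3.

Lemma surf_cube_re x : ~ crest x -> cube_re (surf eta x) = r x ^+ 3 * (1 - 3 * s x ^+ 2).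
Proof. by move=> hx; rewrite /cube_re surf_v // -/(r x); ring. Qed.

Lemma surf_cube_im x : ~ crest x ->
  cube_im (surf eta x) = - (r x ^+ 3 * (3 * s x - s x ^+ 3)).
Proof. by move=> hx; rewrite /cube_im surf_v // -/(r x); ring. Qed.

(** In [r ^+ 3 * (1 - 3 * s ^+ 2)] both factors are nonnegative and nondecreasing towards the
    trough: [s ^+ 2] decreases by convexity, and Bernoulli's law then makes [r] increase. The crest
    is treated apart because the formula needs a slope; the cube vanishes there. *)
Lemma cube_re_mono x y : 0 <= x -> x <= y -> y <= pi ->
  cube_re (surf eta x) <= cube_re (surf eta y).
Proof.
move=> x0 xy ypi.
have p0 := @pi_gt0 R.
have pp : pi < 2 * pi :> R by move: p0; move: pi => p; lra.
have pos t : 0 < t -> t <= pi -> 0 <= r t ^+ 3 /\ 0 <= 1 - 3 * s t ^+ 2.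
  move=> t0 tp; have ht : 0 < t < 2 * pi by rewrite t0 (le_lt_trans tp).
  split; first by rewrite exprn_ge0 // ltW // surf_speed_gt0 //; exact: ncr.
  by rewrite subr_ge0; exact: slope_bound.
move: x0; rewrite le_eqVlt => /predU1P[x0|x0].
  have [u0 v0] := esw_stagnation hw (@crest0 R).
  rewrite -x0 {1}/cube_re /rho u0 v0 subrr expr0n /= mulr0 mul0r subr0.
  move: xy; rewrite -x0 le_eqVlt => /predU1P[<-|y0].
    by rewrite /cube_re /rho u0 v0 subrr expr0n /= mulr0 mul0r subr0.
  have hy : 0 < y < 2 * pi by rewrite y0 (le_lt_trans ypi).
  have [h1 h2] := pos _ y0 ypi.
  by rewrite (surf_cube_re (ncr hy)) mulr_ge0.
have y0 : 0 < y by apply: lt_le_trans xy.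
have hy : 0 < y < 2 * pi by rewrite y0 (le_lt_trans ypi).
have hx : 0 < x < 2 * pi by rewrite x0 (le_lt_trans _ pp) // (le_trans xy).
rewrite (surf_cube_re (ncr hx)) (surf_cube_re (ncr hy)).
have [h1 h2] := pos _ x0 (le_trans xy ypi); have [h3 h4] := pos _ y0 ypi.
have sx := slope_le0 x0 (le_trans xy ypi); have sy := slope_le0 y0 ypi.
have sxy : s x <= s y by apply: slope_mono => //; case/andP: hy.
have s2 : s y ^+ 2 <= s x ^+ 2 by nra.
have exy : eta y <= eta x by apply: eta_decr => //; exact: ltW.
have rx := surf_speed_gt0 (ncr hx); have ry := surf_speed_gt0 (ncr hy).
have bx := surf_bernoulli (ncr hx); have by_ := surf_bernoulli (ncr hy).
have r2 : r x ^+ 2 <= r y ^+ 2.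
  have : r x ^+ 2 * (1 + s x ^+ 2) <= r y ^+ 2 * (1 + s y ^+ 2).
    by rewrite bx by_; have := hg; nra.
  by have := sqr_ge0 (s y); have := sqr_ge0 (r x); nra.
have rxy : r x <= r y by rewrite -ler_sqr ?nnegrE // ltW.
apply: ler_pM => //; last by lra.
by apply: lerXn2r; rewrite ?nnegrE // ltW.
Qed.

(** The bound is [3 * g / 2] times the x-derivative of q along the surface. The term containing the
    second derivative of [eta] has a favourable sign by convexity and [3 * s x ^+ 2 <= 1]; what
    remains is the inequality that fixes the constant. *)
Lemma cube_im_der x : 0 < x < 2 * pi -> exists2 d,
  der (fun t => cube_im (surf eta t)) x d &
  d <= 3 * g / 2 * (r x * (1 + s x ^+ 2)).
Proof.
move=> hx; have nx : \forall t \near x, 0 < t < 2 * pi.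
  case/andP: hx => x0 x1; near=> t; apply/andP; split; near: t.
    exact: lt_nbhsr.
  exact: lt_nbhsl.
have rp t : 0 < t < 2 * pi -> 0 < r t by move=> /ncr; exact: surf_speed_gt0.
(* Bernoulli's law expresses [r ^+ 2] through [eta] and its slope, so [r] is differentiated as the
   square root of [W] and no derivative of [u] at the surface enters. *)
pose W t := 2 * g * (eta 0 - eta t) * (1 + s t * s t)^-1.
have s1 t : 0 < 1 + s t * s t by have := sqr_ge0 (s t); rewrite expr2; lra.
have WE t : 0 < t < 2 * pi -> W t = r t ^+ 2.
  move=> ht; rewrite /W -surf_bernoulli; last exact: ncr.
  by rewrite -mulrA -[s t ^+ 2]/(s t * s t) divff ?mulr1 // gt_eqF.
have dW : der W x (2 * g * (0 - s x) * (1 + s x * s x)^-1 +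
    2 * g * (eta 0 - eta x) *
     (- (0 + (derive1 s x * s x + s x * derive1 s x)) / (1 + s x * s x) ^+ 2)).
  have ds := der_slope (ncr hx).
  apply: derM; first by apply: derZ; apply: derB; [exact: der_cst|exact: der_eta (ncr hx)].
  apply: (derV (f := fun t => 1 + s t * s t)); first by rewrite gt_eqF.
  by apply: derD; [exact: der_cst|exact: derM].
have Wx : 0 < W x by rewrite WE // exprn_gt0 // rp.
have dr0 := der_comp (is_derive1_sqrt Wx) dW.
set dr := (X in der _ _ X) in dr0.
have dr1 : der r x dr.
  apply: der_near dr0; apply: filterS nx => t ht.
  by rewrite WE // sqrtr_sqr gtr0_norm // rp.
have ds := der_slope (ncr hx).
exists (- (((dr * r x + r x * dr) * r x + r x * r x * dr) * (3 * s x - s x * s x * s x)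
  + r x * r x * r x * (3 * derive1 s x - ((derive1 s x * s x + s x * derive1 s x) * s x
     + s x * s x * derive1 s x)))).
  apply: (@der_near _ (fun t => - (r t * r t * r t * (3 * s t - s t * s t * s t)))).
    by apply: filterS nx => t /ncr ht; rewrite surf_cube_im //; ring.
  apply: derN; apply: derM; first by do 2 apply: derM => //.
  by apply: derB; [exact: derZ|do 2 apply: derM => //].
have sqW : Num.sqrt (W x) = r x by rewrite WE // sqrtr_sqr gtr0_norm // rp.
have b := surf_bernoulli (ncr hx).
(* This is half the derivative of the identity [surf_bernoulli]. *)
have drE : dr * (r x * (1 + s x ^+ 2)) = - (g * s x) - r x ^+ 2 * s x * derive1 s x.
  rewrite /dr sqW -b; field.
  by apply/andP; split; apply: lt0r_neq0; [exact: s1|exact: rp].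
have rx := rp _ hx; have sx := slope_bound hx; have s'x := slope_der_ge0 hx.
have s1x : 0 < 1 + s x ^+ 2 by have := sqr_ge0 (s x); lra.
rewrite -(ler_pM2r s1x).
set S := s x in sx s1x drE *; set S' := derive1 s x in s'x drE *.
set Q := r x in rx drE *.
have -> : - (((dr * Q + Q * dr) * Q + Q * Q * dr) * (3 * S - S * S * S)
    + Q * Q * Q * (3 * S' - ((S' * S + S * S') * S + S * S * S'))) * (1 + S ^+ 2) =
  - (3 * Q * (dr * (Q * (1 + S ^+ 2))) * (3 * S - S * S * S)
     + Q ^+ 3 * (3 * S' - 3 * S ^+ 2 * S') * (1 + S ^+ 2)) by ring.
rewrite drE.
have -> : - (3 * Q * (- (g * S) - Q ^+ 2 * S * S') * (3 * S - S * S * S)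
     + Q ^+ 3 * (3 * S' - 3 * S ^+ 2 * S') * (1 + S ^+ 2)) =
  3 * g * Q * (S ^+ 2 * (3 - S ^+ 2)) - 3 * (Q ^+ 3 * S') * (1 - 3 * S ^+ 2) by ring.
have h1 : 0 <= Q ^+ 3 * S' by rewrite mulr_ge0 // exprn_ge0 // ltW.
have h2 : 0 <= (Q ^+ 3 * S') * (1 - 3 * S ^+ 2) by rewrite mulr_ge0 //; lra.
have gQ : 0 < g * Q by rewrite mulr_gt0.
(* With w = [S ^+ 2], the difference of the two sides is (1 - 3 w) (1 - w), which vanishes at the
   corner slope. *)
have h3 : 2 * (S ^+ 2 * (3 - S ^+ 2)) <= (1 + S ^+ 2) ^+ 2.
  have := sqr_ge0 S; move: (S ^+ 2) sx => w; nra.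
have h4 := ler_wpM2l (ltW gQ) h3.
lra.
Unshelve. all: by end_near. Qed.

End Surface.

(** * The hodograph plane *)

Section HoloMul.
Context {R : realType} (eta : R -> R) (ceta : continuous eta).

Lemma holo_cst (k l : R) :
  holo eta (fun=> k) (fun=> l) (fun=> 0) (fun=> 0).
Proof.
apply: holo_intro => // [z hz|z hz|z hz]; try exact: cvg_cst.
by split; split; rewrite ?oppr0; exact: der_cst.
Qed.

Lemma holo_mul (a b a' b' c d c' d' : R * R -> R) :
  holo eta a b a' b' -> holo eta c d c' d' ->
  holo eta (fun z => a z * c z - b z * d z) (fun z => a z * d z + b z * c z)
    (fun z => a' z * c z - b' z * d z + (a z * c' z - b z * d' z))
    (fun z => a' z * d z + b' z * c z + (a z * d' z + b z * c' z)).
Proof.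
move=> h1 h2; apply: holo_intro => // z hz.
- have [[a1 a3] [b1 b3]] := holo_partials h1 hz.
  have [[c1 c3] [d1 d3]] := holo_partials h2 hz.
  split; split.
  + apply: (der_val (derB (derM a1 c1) (derM b1 d1))).
    by rewrite -surjective_pairing; ring.
  + apply: (der_val (derB (derM a3 c3) (derM b3 d3))).
    by rewrite -surjective_pairing; ring.
  + apply: (der_val (derD (derM a1 d1) (derM b1 c1))).
    by rewrite -surjective_pairing; ring.
  + apply: (der_val (derD (derM a3 d3) (derM b3 c3))).
    by rewrite -surjective_pairing; ring.
- have [ca cb] := holo_cont h1 hz; have [cc cd] := holo_cont h2 hz.
  have [_ [_ cb' ca']] := h1 z hz; have [_ [_ cd' cc']] := h2 z hz.
  by apply: cvgD; apply: cvgB; apply: cvgM.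
- have [ca cb] := holo_cont h1 hz; have [cc cd] := holo_cont h2 hz.
  have [_ [_ cb' ca']] := h1 z hz; have [_ [_ cd' cc']] := h2 z hz.
  by apply: cvgD; apply: cvgD; apply: cvgM.
Qed.

Lemma holo_eq (a b a' b' c d c' d' : R * R -> R) :
  a =1 c -> b =1 d -> a' =1 c' -> b' =1 d' ->
  holo eta a b a' b' -> holo eta c d c' d'.
Proof. by move=> /funext -> /funext -> /funext -> /funext ->. Qed.

Lemma partials_affine (f f1 f2 : R * R -> R) (k l : R) z :
  partials f f1 f2 (k * z.1 + l, z.2) ->
  partials (fun w => f (k * w.1 + l, w.2))
    (fun w => k * f1 (k * w.1 + l, w.2)) (fun w => f2 (k * w.1 + l, w.2)) z.
Proof.
move=> [/= h1 h2]; split => //=.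
exact: (der_affine (u := fun s => f (s, z.2))).
Qed.

Lemma affine_within (f : R * R -> R) (k l : R) :
  (forall x, eta (k * x + l) = eta x) ->
  {within cl_fluid eta, continuous f} ->
  {within cl_fluid eta, continuous (fun w => f (k * w.1 + l, w.2))}.
Proof.
move=> he cf.
apply: (within_comp (k := fun w : R * R => (k * w.1 + l, w.2)) cf).
  apply: continuous_subspaceT => z.
  apply: (@cvg_pair _ _ _ _ (nbhs (k * z.1 + l)) (nbhs z.2) _ _ _
    (fun w : R * R => k * w.1 + l) snd); last exact: cvg_snd.
  apply: cvgD; last exact: cvg_cst.
  by apply: cvgM; [exact: cvg_cst|exact: cvg_fst].
by move=> z; rewrite /cl_fluid /= he.
Qed.

End HoloMul.

(** * The hodograph map and its symmetries *)

Section Hodograph.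
Context {R : realType} (g c P0 : R) (eta : R -> R) (u v P : R * R -> R).
Context (hg : 0 < g) (hc : 0 < c).
Context (hw : extreme_stokes_wave g c P0 eta u v P).
Context (al be al2 be2 : R * R -> R).
Context (jet1 : holo eta (fun z => c - u z) v al be)
  (jet2 : holo eta al be al2 be2).
Context (phi psi : R * R -> R) (gam : R * R -> R * R).
Context (hphi : velocity_potential c eta u v phi)
  (hpsi : stream_function c eta u v psi).
Context (hin : forall z, cl_fluid eta z ->
  lower_half_plane (- phi z, - psi z) /\ gam (- phi z, - psi z) = z).
Context (hout : forall w, lower_half_plane w ->
  cl_fluid eta (gam w) /\ (- phi (gam w), - psi (gam w)) = w).

Let hs := esw_stokes hw.
Let hww := sw_wave hs.
Let rho (z : R * R) := c - u z.
Let ceta : continuous eta := wave_eta_cont hw.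
Let q (z : R * R) := - phi z.
Let p (z : R * R) := - psi z.
Let p2 := 2 * (pi : R).

Let surf_cl x : cl_fluid eta (surf eta x).
Proof. by rewrite /cl_fluid /surf /=. Qed.

Lemma q_cont : {within cl_fluid eta, continuous q}.
Proof. by have [h _ _] := hphi; move=> z; apply: cvgN; exact: h. Qed.

Lemma p_cont : {within cl_fluid eta, continuous p}.
Proof. by have [h _ _] := hpsi; move=> z; apply: cvgN; exact: h. Qed.

Let crho z : fluid eta z -> {for z, continuous rho}.
Proof. by move=> hz; apply: (fluid_cont ceta (rho_cont hw) hz). Qed.

Let cv z : fluid eta z -> {for z, continuous v}.
Proof. by move=> hz; apply: (fluid_cont ceta _ hz); exact: (ww_v_cont hww). Qed.

Lemma hodograph_holo : holo eta q p rho v.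
Proof.
apply: holo_intro => // z hz.
have [_ h _] := hphi; have [h1 h2] := h z hz.
have [_ k _] := hpsi; have [k1 k2] := k z hz.
have rE : rho z = - (u z - c) by rewrite opprB.
split; split; rewrite ?rE; try exact: derN (is_derive_exE _);
  try exact: derN (is_derive_eyE _).
  by have := derN (is_derive_exE k1); rewrite opprK.
Qed.

Lemma p_surf x : p (surf eta x) = 0.
Proof. by have [_ _ h] := hpsi; rewrite /p h oppr0. Qed.

Lemma q_axis y : y <= eta 0 -> q (0, y) = 0.
Proof. by have [_ _ h] := hphi; move=> /h; rewrite /q => ->; rewrite oppr0. Qed.

Let eta_neg x : eta (-1 * x + 0) = eta x.
Proof. by rewrite mulN1r addr0 (eta_even hw). Qed.

Let eta_shift x : eta (1 * x + p2) = eta x.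
Proof. by rewrite mul1r (sw_eta_per hs). Qed.

Let fluid_affine (k l : R) z : (forall x, eta (k * x + l) = eta x) ->
  fluid eta z -> fluid eta (k * z.1 + l, z.2).
Proof. by move=> h; rewrite /fluid /= h. Qed.

Let rho_neg z : cl_fluid eta z -> rho (-1 * z.1 + 0, z.2) = rho z.
Proof. by move=> hz; rewrite /rho mulN1r addr0 (sw_u_even hs). Qed.

Let v_neg z : cl_fluid eta z -> v (-1 * z.1 + 0, z.2) = - v z.
Proof. by move=> hz; rewrite mulN1r addr0 (sw_v_odd hs). Qed.

Let rho_shift z : cl_fluid eta z -> rho (1 * z.1 + p2, z.2) = rho z.
Proof. by move=> hz; rewrite /rho mul1r (sw_u_per hs). Qed.

Let v_shift z : cl_fluid eta z -> v (1 * z.1 + p2, z.2) = v z.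
Proof. by move=> hz; rewrite mul1r (sw_v_per hs). Qed.

(** One statement for four symmetries: [(k, l, e)] is [(-1, 0, 1)] for oddness of [q], [(-1, 0, -1)]
    for evenness of [p], and [(1, p2, -1)] for the shift by a period of either. The combination has
    zero gradient, and its constant value is read off at the crest. *)
Let affine_const (f f1 f2 : R * R -> R) (k l e : R) :
  (forall x, eta (k * x + l) = eta x) ->
  {within cl_fluid eta, continuous f} ->
  (forall z, fluid eta z -> partials f f1 f2 z) ->
  (forall z, fluid eta z -> k * f1 (k * z.1 + l, z.2) + e * f1 z = 0) ->
  (forall z, fluid eta z -> f2 (k * z.1 + l, z.2) + e * f2 z = 0) ->
  forall z z', cl_fluid eta z -> cl_fluid eta z' ->
  f (k * z.1 + l, z.2) + e * f z = f (k * z'.1 + l, z'.2) + e * f z'.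
Proof.
move=> he cf df e1 e2 z z' hz hz'.
apply: (grad0_const (f := fun z => f (k * z.1 + l, z.2) + e * f z) ceta) => //.
  move=> w; apply: cvgD; first exact: (affine_within he cf).
  by apply: cvgM; [exact: cvg_cst|exact: cf].
move=> w hw'; have [h1 h2] := df _ hw'.
have [k1 k2] := partials_affine (df _ (fluid_affine he hw')).
split.
  by apply: (der_val (derD k1 (derZ e h1))); exact: e1.
by apply: (der_val (derD k2 (derZ e h2))); exact: e2.
Qed.

Let dq z : fluid eta z -> partials q rho (fun w => - v w) z.
Proof. by move=> /(holo_partials hodograph_holo)[]. Qed.

Let dp z : fluid eta z -> partials p v rho z.
Proof. by move=> /(holo_partials hodograph_holo)[]. Qed.

Let q0 : q (surf eta 0) = 0. Proof. exact: q_axis. Qed.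
Let p0 : p (surf eta 0) = 0. Proof. exact: p_surf. Qed.

Lemma q_odd x y : y <= eta x -> q (- x, y) = - q (x, y).
Proof.
move=> h; have := affine_const (e := 1) eta_neg q_cont dq _ _
  (z := (x, y)) (z' := surf eta 0) h (surf_cl 0).
rewrite /= !mulN1r !addr0 !mul1r oppr0 q0 addr0 => H.
apply/eqP; rewrite -addr_eq0; apply/eqP; apply: H => z hz.
- by rewrite rho_neg ?mulN1r ?mul1r ?addNr //; exact: fluid_cl.
- by rewrite v_neg ?mul1r ?opprK ?subrr //; exact: fluid_cl.
Qed.

Lemma p_even x y : y <= eta x -> p (- x, y) = p (x, y).
Proof.
move=> h; have := affine_const (e := -1) eta_neg p_cont dp _ _
  (z := (x, y)) (z' := surf eta 0) h (surf_cl 0).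
rewrite /= !mulN1r !addr0 oppr0 subrr => H.
apply/eqP; rewrite -subr_eq0; apply/eqP; apply: H => z hz.
- by rewrite v_neg ?mulN1r ?mul1r ?opprK ?subrr //; exact: fluid_cl.
- by rewrite rho_neg ?mulN1r ?subrr //; exact: fluid_cl.
Qed.

Definition q_period := q (surf eta p2).
Let L := q_period.

Lemma q_shift x y : y <= eta x -> q (x + p2, y) = q (x, y) + L.
Proof.
move=> h; have := affine_const (e := -1) eta_shift q_cont dq _ _
  (z := (x, y)) (z' := surf eta 0) h (surf_cl 0).
rewrite /= !mul1r add0r !mulN1r q0 subr0.
have -> : q (p2, eta 0) = L.
  by rewrite /L /q_period /surf -(eta_shift 0) mulr0 add0r.
move=> H; apply/eqP; rewrite [_ + L]addrC -subr_eq; apply/eqP; apply: H => z hz.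
- by rewrite rho_shift ?mulN1r ?mul1r ?subrr //; exact: fluid_cl.
- by rewrite v_shift ?mulN1r ?subrr //; exact: fluid_cl.
Qed.

Lemma p_shift x y : y <= eta x -> p (x + p2, y) = p (x, y).
Proof.
move=> h; have := affine_const (e := -1) eta_shift p_cont dp _ _
  (z := (x, y)) (z' := surf eta 0) h (surf_cl 0).
rewrite /= !mul1r add0r !mulN1r.
have -> : p (p2, eta 0) = 0.
  by rewrite -(eta_shift 0) mulr0 add0r; exact: p_surf.
rewrite p0 subr0 => H; apply/eqP; rewrite -subr_eq0; apply/eqP; apply: H => z hz.
- by rewrite v_shift ?mulN1r ?mul1r ?subrr //; exact: fluid_cl.
- by rewrite rho_shift ?mulN1r ?subrr //; exact: fluid_cl.
Qed.

Lemma q_pi y : y <= eta pi -> q (pi, y) = L / 2.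
Proof.
move=> h; have h' : y <= eta (- pi) by rewrite (eta_even hw).
have := q_shift h'; rewrite q_odd //.
have -> : - pi + p2 = pi by rewrite /p2; move: pi => t; ring.
by lra.
Qed.

Lemma p_lt0 z : fluid eta z -> p z < 0.
Proof.
case: z => x y hz; rewrite -(p_surf x).
have d t : y < t < eta x -> der (fun s => p (x, s)) t (rho (x, t)).
  by move=> /andP[_ t1]; have [] := dp (z := (x, t)) t1.
have [t /andP[_ t1] e] := mvt hz d (vertical_within (a := y) p_cont (lexx (eta x))).
have r0 : 0 < rho (x, t) := fluid_speed_gt0 hw (z := (x, t)) t1.
by rewrite -subr_gt0 e mulr_gt0 // subr_gt0; exact: hz.
Qed.

(** * The inverse of the hodograph map *)

Lemma gam_fluid w : w.2 < 0 -> fluid eta (gam w).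
Proof.
move=> w2; have [hcl e] := hout (ltW w2).
have [//|eg] := cl_fluidP hcl.
have : p (gam w) = w.2 := congr1 snd e.
by rewrite eg p_surf => e0; move: w2; rewrite -e0 ltxx.
Qed.

Lemma gam_surf t : gam (t, 0) = surf eta (gam (t, 0)).1.
Proof.
have [|hcl e] := hout (w := (t, 0)); first by rewrite /lower_half_plane /=.
have [/p_lt0|//] := cl_fluidP hcl.
by have -> : p (gam (t, 0)) = 0 := congr1 snd e; rewrite ltxx.
Qed.

Lemma gam_neg w : lower_half_plane w ->
  gam (- w.1, w.2) = (- (gam w).1, (gam w).2).
Proof.
move=> hwl; have [hcl e] := hout hwl.
have hcl' : (gam w).2 <= eta (gam w).1 by [].
have hcl2 : cl_fluid eta (- (gam w).1, (gam w).2).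
  by rewrite /cl_fluid /= (eta_even hw).
have [_ <-] := hin hcl2.
have := q_odd hcl'; have := p_even hcl'; rewrite -surjective_pairing.
have -> : p (gam w) = w.2 := congr1 snd e.
have -> : q (gam w) = w.1 := congr1 fst e.
by rewrite /q /p => -> ->.
Qed.

Lemma gam_shift w : lower_half_plane w ->
  gam (w.1 + L, w.2) = ((gam w).1 + p2, (gam w).2).
Proof.
move=> hwl; have [hcl e] := hout hwl.
have hcl' : (gam w).2 <= eta (gam w).1 by [].
have hcl2 : cl_fluid eta ((gam w).1 + p2, (gam w).2).
  by rewrite /cl_fluid /= (sw_eta_per hs).
have [_ <-] := hin hcl2.
have := q_shift hcl'; have := p_shift hcl'; rewrite -surjective_pairing.
have -> : p (gam w) = w.2 := congr1 snd e.
have -> : q (gam w) = w.1 := congr1 fst e.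
by rewrite /q /p => -> ->.
Qed.

(* Properness of the hodograph map, hence continuity of its inverse, comes from
   the depth, where c - u >= c / 2. *)
Lemma q_deep Y x : (forall t, Y < eta t) ->
  (forall t y, y <= Y -> `|u (t, y)| < c / 2) -> c / 2 * `|x| <= `|q (x, Y)|.
Proof.
move=> hY uY.
wlog x0 : x / 0 <= x.
  move=> H; have [/H //|x0] := leP 0 x.
  have := H (- x); rewrite q_odd ?(ltW (hY _)) // !normrN; apply.
  by rewrite oppr_ge0 ltW.
move: x0; rewrite le_eqVlt => /predU1P[<-|x0].
  by rewrite normr0 mulr0 normr_ge0.
have d t : 0 <= t <= x -> der (fun s => q (s, Y)) t (rho (t, Y)).
  by move=> _; have [] := dq (z := (t, Y)) (hY t).
have d' t : 0 < t < x -> der (fun s => q (s, Y)) t (rho (t, Y)).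
  by move=> /andP[? ?]; apply: d; rewrite !ltW.
have [t _ e] := mvt x0 d' (der_within d).
rewrite subr0 q_axis ?subr0 in e; last by rewrite ltW.
have r0 : 0 < rho (t, Y) := fluid_speed_gt0 hw (z := (t, Y)) (hY t).
rewrite e normrM !gtr0_norm //.
rewrite ler_pM2r // /rho.
by have := uY t Y (lexx _); rewrite ltr_norml => /andP[_]; lra.
Qed.

Lemma q_period_gt0 : 0 < L.
Proof.
have [Y [hY uY]] := deep_bound hc hw.
have d t : 0 <= t <= pi -> der (fun s => q (s, Y)) t (rho (t, Y)).
  by move=> _; have [] := dq (z := (t, Y)) (hY t).
have d' t : 0 < t < pi -> der (fun s => q (s, Y)) t (rho (t, Y)).
  by move=> /andP[? ?]; apply: d; rewrite !ltW.
have pi0 := @pi_gt0 R.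
have [t _ e] := mvt pi0 d' (der_within d).
have r0 : 0 < rho (t, Y) := fluid_speed_gt0 hw (z := (t, Y)) (hY t).
have : 0 < q (pi, Y) - q (0, Y) by rewrite e subr0 mulr_gt0.
by rewrite q_axis ?q_pi ?ltW //; lra.
Qed.

(** Below level [Y] the function [p] grows in y at rate at least [c / 2], so bounded [p] keeps y
    above [Yb]. Since q_y = - v is bounded, [q (x, Y)] then differs from [q (x, y)] by a bounded
    amount, and [q_deep] bounds x by [X]. *)
Lemma gam_bounded w0 : exists B : R, forall w, lower_half_plane w ->
  `|w.1 - w0.1| < 1 -> `|w.2 - w0.2| < 1 ->
  `|(gam w).1| <= B /\ - B <= (gam w).2.
Proof.
have [Y [hY uY]] := deep_bound hc hw.
have [K hK] := flow_bounded hg hc hw.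
pose Yb := Y - 2 / c * (`|w0.2| + 1).
pose X := 2 / c * (`|w0.1| + 1 + `|K| * (eta 0 - Yb)).
have c0 : 0 < 2 / c by rewrite divr_gt0.
have YbY : Yb <= Y.
  by rewrite /Yb gerBl mulr_ge0 ?ltW // ltr_wpDl.
exists (`|X| + `|Yb|) => w hwl w1 w2.
have [hcl e] := hout hwl.
have := congr1 fst e; have := congr1 snd e; rewrite /= -/(p _) -/(q _).
case: (gam w) hcl => x y /= hcl py qx.
have yYb : Yb <= y.
  have [Yy|yY] := leP Y y; first exact: le_trans Yy.
  have d t : y < t < Y -> der (fun s => p (x, s)) t (rho (x, t)).
    by move=> /andP[_ tY]; have [] := dp (z := (x, t)) (lt_trans tY (hY x)).
  have [t /andP[_ tY] et] :=
    mvt yY d (vertical_within (a := y) p_cont (ltW (hY x))).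
  have pY : p (x, Y) < 0 by apply: p_lt0; exact: hY.
  have r0 : c / 2 <= rho (x, t).
    have := uY x t (ltW tY); rewrite /rho ltr_norml => /andP[_].
    by have := hc; lra.
  have w2' : - (`|w0.2| + 1) <= w.2.
    by move: w2; rewrite ltr_norml => /andP[]; have := lerNnormlW (lexx `|w0.2|); lra.
  have h : c / 2 * (Y - y) <= `|w0.2| + 1.
    have yY' : 0 <= Y - y by lra.
    by have := ler_wpM2r yY' r0; rewrite -et py; lra.
  have : Y - y <= 2 / c * (`|w0.2| + 1).
    rewrite -(ler_pM2l (x := c / 2)) ?divr_gt0 // mulrA.
    by rewrite (_ : c / 2 * (2 / c) = 1) ?mul1r //; field; have := hc; lra.
  by rewrite /Yb; lra.
have yeta : y <= eta 0 by apply: le_trans hcl (eta_le0 hg hw x).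
have qd : `|q (x, y) - q (x, Y)| <= `|K| * (eta 0 - Yb).
  have H a b : a < b -> b <= eta x -> `|q (x, b) - q (x, a)| <= `|K| * (b - a).
    move=> ab bx; have d t : a < t < b -> der (fun s => q (x, s)) t (- v (x, t)).
      by move=> /andP[_ tb]; have [] := dq (z := (x, t)) (lt_le_trans tb bx).
    have [t /andP[_ tb] ->] := mvt ab d (vertical_within (a := a) q_cont bx).
    rewrite normrM normrN [`|b - a|]gtr0_norm ?subr_gt0 // ler_pM2r ?subr_gt0 //.
    have [|_ vK] := hK (x, t); first exact: ltW (lt_le_trans tb bx).
    by apply: le_trans vK (ler_norm _).
  have Y0 : Y < eta 0 by [].
  have K0 := normr_ge0 K.
  case: (ltgtP y Y) => [yY|Yy|->].
  - rewrite distrC; apply: le_trans (H _ _ yY (ltW (hY x))) _.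
    by apply: ler_wpM2l => //; lra.
  - apply: le_trans (H _ _ Yy hcl) _; apply: ler_wpM2l => //; lra.
  - by rewrite subrr normr0 mulr_ge0 //; lra.
have xX : `|x| <= X.
  have h := q_deep x hY uY.
  have h2 : `|q (x, Y)| <= `|w0.1| + 1 + `|K| * (eta 0 - Yb).
    rewrite (_ : q (x, Y) = w0.1 + (w.1 - w0.1) - (q (x, y) - q (x, Y))); last first.
      by rewrite qx; ring.
    apply: le_trans (ler_normB _ _) _; apply: lerD => //.
    by apply: le_trans (ler_normD _ _) _; apply: lerD => //; exact: ltW.
  rewrite -(ler_pM2l (x := c / 2)) ?divr_gt0 // /X mulrA.
  rewrite (_ : c / 2 * (2 / c) = 1) ?mul1r; first exact: le_trans h h2.
  by field; have := hc; lra.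
split.
  by apply: le_trans xX _; apply: le_trans (ler_norm X) _; rewrite lerDl.
have := ler_norm (- Yb); rewrite normrN; have := normr_ge0 X; lra.
Qed.

(** Compactness argument: the points of a bounded piece of the closed fluid domain that lie outside
    the interior of [U] form a compact set, whose image under [W] is closed and misses [w] because
    [gam] inverts [W]. Near [w] the values of [gam] stay in the bounded piece, hence in [U]. *)
Lemma gam_cont : {within lower_half_plane, continuous gam}.
Proof.
apply/subspace_continuousP => w hwl U nU.
have [B hB] := gam_bounded w.
pose Q : set (R * R) := `[- B, B]%classic `*` `[- B, eta 0]%classic.
pose C := (Q `&` cl_fluid eta) `&` ~` U^°.
have cC : compact C.
  apply: compact_closedI; last by apply: open_closedC; exact: open_interior.
  apply: compact_closedI; last exact: closed_cl_fluid.
  by apply: compact_setX; exact: segment_compact.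
pose W z := (q z, p z).
have cW : {within C, continuous W}.
  have CS : C `<=` cl_fluid eta by move=> z [[]].
  move=> z; apply: (@cvg_pair _ _ _ _ (nbhs (q z)) (nbhs (p z)) _ _ _ q p).
    exact: (continuous_subspaceW CS q_cont).
  exact: (continuous_subspaceW CS p_cont).
have clD : closed (W @` C).
  by apply: compact_closed (continuous_compact cW cC); exact: norm_hausdorff.
have wD : (~` (W @` C)) w.
  move=> [z [[_ hz] nz] Wz]; apply: nz.
  by have [_ gz] := hin hz; rewrite -gz -/(p z) -/(q z) -/(W z) Wz; exact: nU.
have nD : nbhs w (~` (W @` C)) by apply: open_nbhs_nbhs; split => //; exact: closed_openC.
have nb : \forall w' \near w, `|w'.1 - w.1| < 1 /\ `|w'.2 - w.2| < 1.
  by apply/near_box; exists 1.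
rewrite !nbhs_simpl /within /=.
apply: filterS2 nD nb => w' nD' [b1 b2] hwl'.
have [hcl e] := hout hwl'.
apply: contrapT => nU'; apply: nD'; exists (gam w'); last exact: e.
split; last by move=> /interior_subset.
split => //; have [x1 y1] := hB w' hwl' b1 b2.
split => /=; rewrite in_itv /=; first by rewrite -ler_norml.
by rewrite y1 /=; apply: le_trans hcl (eta_le0 hg hw _).
Qed.

Lemma gam_for w : w.2 < 0 -> {for w, continuous gam}.
Proof.
move=> w2; apply: (within_for gam_cont).
have : \forall t \near w.2, t < 0 by exact: lt_nbhsl.
move=> /near_ball[d d0 hd]; apply/near_box; exists d => // x y _ hy.
by apply: ltW; exact: hd.
Qed.

(** * Differentiation in the hodograph variable *)

Let J z := rho z ^+ 2 + v z ^+ 2.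

Let J0 z : fluid eta z -> 0 < J z.
Proof.
move=> hz; have : 0 < rho z := fluid_speed_gt0 hw hz.
by rewrite /J => h; have := sqr_ge0 (v z); have := exprn_gt0 2 h; lra.
Qed.

Let q_gam w : lower_half_plane w -> q (gam w) = w.1.
Proof. by move=> /hout[_ e]; exact: (congr1 fst e). Qed.

Let p_gam w : lower_half_plane w -> p (gam w) = w.2.
Proof. by move=> /hout[_ e]; exact: (congr1 snd e). Qed.

(** In components, dz/dw = 1 / F = conj F / |F|^2. *)
Lemma gam_der w : w.2 < 0 -> let z := gam w in
  [/\ der (fun s => (gam (s, w.2)).1) w.1 (rho z / J z),
      der (fun s => (gam (s, w.2)).2) w.1 (- v z / J z),
      der (fun s => (gam (w.1, s)).1) w.2 (v z / J z) &
      der (fun s => (gam (w.1, s)).2) w.2 (rho z / J z)].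
Proof.
case: w => a b /= b0; set z := gam (a, b).
have hz : fluid eta z by exact: gam_fluid.
have [cq cp] := hodograph_holo hz.
have Jz := J0 hz.
have cg : {for (a, b), continuous gam} by exact: gam_for.
have cx : {for a, continuous (fun s => gam (s, b))}.
  apply: (continuous_comp (f := fun s => (s, b)) (g := gam)) => //.
  exact: (@continuous_pair R id (fun=> b) a cvg_id (cvg_cst b)).
have cy : {for b, continuous (fun s => gam (a, s))}.
  apply: (continuous_comp (f := fun s => (a, s)) (g := gam)) => //.
  exact: (@continuous_pair R (fun=> a) id b (cvg_cst a) cvg_id).
have zE : z = (z.1, z.2) := surjective_pairing z.
have lb : lower_half_plane (a, b) by exact: ltW.
rewrite zE in cq cp Jz.
have J0z : rho (z.1, z.2) * rho (z.1, z.2) - - v (z.1, z.2) * v (z.1, z.2) != 0.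
  by apply: lt0r_neq0; move: Jz; rewrite /J !expr2 mulNr opprK.
have cg1 (k : R -> R * R) t : {for t, continuous k} ->
    {for t, continuous (fun s => (k s).1)} /\ {for t, continuous (fun s => (k s).2)}.
  by move=> ck; split; apply: (continuous_comp ck); [exact: cvg_fst|exact: cvg_snd].
have [cx1 cx2] := cg1 _ _ cx; have [cy1 cy2] := cg1 _ _ cy.
have nX : \forall s \near a,
    q ((gam (s, b)).1, (gam (s, b)).2) - q (z.1, z.2) = 1 * (s - a) /\
    p ((gam (s, b)).1, (gam (s, b)).2) - p (z.1, z.2) = 0 * (s - a).
  apply/near_ball; exists 1 => // s _; rewrite -!surjective_pairing.
  have ls : lower_half_plane (s, b) by exact: ltW.
  by rewrite (q_gam ls) (p_gam ls) (q_gam lb) (p_gam lb) mul1r mul0r subrr.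
have nY : \forall s \near b,
    q ((gam (a, s)).1, (gam (a, s)).2) - q (z.1, z.2) = 0 * (s - b) /\
    p ((gam (a, s)).1, (gam (a, s)).2) - p (z.1, z.2) = 1 * (s - b).
  have nb : \forall s \near b, s < 0 by exact: lt_nbhsl.
  apply: filterS nb => s s0; rewrite -!surjective_pairing.
  have ls : lower_half_plane (a, s) by exact: ltW.
  by rewrite (q_gam ls) (p_gam ls) (q_gam lb) (p_gam lb) mul1r mul0r subrr.
have [X1 X2] := @der_inverse R q p _ _ _ _ (fun s => (gam (s, b)).1)
  (fun s => (gam (s, b)).2) a 1 0 cq cp J0z cx1 cx2 nX.
have [Y1 Y2] := @der_inverse R q p _ _ _ _ (fun s => (gam (a, s)).1)
  (fun s => (gam (a, s)).2) b 0 1 cq cp J0z cy1 cy2 nY.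
have JE (x y : R) : x * x - - y * y = x ^+ 2 + y ^+ 2 by ring.
split; [apply: (der_val X1)|apply: (der_val X2)|apply: (der_val Y1)|
  apply: (der_val Y2)]; rewrite /= -/z -surjective_pairing JE;
  by congr (_ / _); ring.
Qed.

(** In components, d/dw = (1 / F) d/dz. *)
Lemma gam_comp f h f1 h1 w : holo eta f h f1 h1 -> w.2 < 0 -> let z := gam w in
  [/\ der (fun s => f (gam (s, w.2))) w.1 ((f1 z * rho z + h1 z * v z) / J z),
      der (fun s => f (gam (w.1, s))) w.2 ((f1 z * v z - h1 z * rho z) / J z),
      der (fun s => h (gam (s, w.2))) w.1 ((h1 z * rho z - f1 z * v z) / J z) &
      der (fun s => h (gam (w.1, s))) w.2 ((h1 z * v z + f1 z * rho z) / J z)].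
Proof.
move=> hh w2 z; have hz : fluid eta z by exact: gam_fluid.
have [cf ch] := hh z hz.
have [X1 X2 Y1 Y2] := gam_der w2.
have Jn : J z != 0 by rewrite gt_eqF ?J0.
have E (F : R * R -> R) : (fun s => F (gam (s, w.2))) =
    fun s => F ((gam (s, w.2)).1, (gam (s, w.2)).2).
  by apply/funext => s; rewrite -surjective_pairing.
have E' (F : R * R -> R) : (fun s => F (gam (w.1, s))) =
    fun s => F ((gam (w.1, s)).1, (gam (w.1, s)).2).
  by apply/funext => s; rewrite -surjective_pairing.
have zE : z = (z.1, z.2) by rewrite -surjective_pairing.
have wE : gam (w.1, w.2) = z by rewrite -surjective_pairing.
rewrite !E !E'; split.
- have := @der_comp2 R f _ _ _ _ w.1 _ _ _ X1 X2; rewrite wE -zE => /(_ _ _ cf) H.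
  by apply: (der_val H); rewrite -/z; field.
- have := @der_comp2 R f _ _ _ _ w.2 _ _ _ Y1 Y2; rewrite wE -zE => /(_ _ _ cf) H.
  by apply: (der_val H); rewrite -/z; field.
- have := @der_comp2 R h _ _ _ _ w.1 _ _ _ X1 X2; rewrite wE -zE => /(_ _ _ ch) H.
  by apply: (der_val H); rewrite -/z; field.
- have := @der_comp2 R h _ _ _ _ w.2 _ _ _ Y1 Y2; rewrite wE -zE => /(_ _ _ ch) H.
  by apply: (der_val H); rewrite -/z; field.
Qed.

(* As dw/dz = F, an analytic function with z-derivative F k has w-derivative k. *)
Lemma gam_comp_grad f h k1 k2 w :
  holo eta f h (fun z => rho z * k1 z - v z * k2 z)
    (fun z => rho z * k2 z + v z * k1 z) -> w.2 < 0 ->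
  [/\ der (fun s => f (gam (s, w.2))) w.1 (k1 (gam w)),
      der (fun s => f (gam (w.1, s))) w.2 (- k2 (gam w)),
      der (fun s => h (gam (s, w.2))) w.1 (k2 (gam w)) &
      der (fun s => h (gam (w.1, s))) w.2 (k1 (gam w))].
Proof.
move=> hh w2; have hz : fluid eta (gam w) by exact: gam_fluid.
have Jn : rho (gam w) ^+ 2 + v (gam w) ^+ 2 != 0 by rewrite gt_eqF // (J0 hz).
have [h1 h2 h3 h4] := gam_comp hh w2.
split; [apply: (der_val h1)|apply: (der_val h2)|apply: (der_val h3)|apply: (der_val h4)];
  by rewrite /J; field.
Qed.

Lemma gam_comp_harmonic f h k1 k2 l1 l2 w :
  holo eta f h (fun z => rho z * k1 z - v z * k2 z)
    (fun z => rho z * k2 z + v z * k1 z) -> holo eta k1 k2 l1 l2 -> w.2 < 0 ->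
  harmonic_at (fun w => f (gam w)) w /\ harmonic_at (fun w => h (gam w)) w.
Proof.
move=> hh hk w2; set z := gam w.
have n2 : \forall s \near w.2, s < 0 by exact: lt_nbhsl.
have [k1x k1y k2x k2y] := gam_comp hk w2.
split.
  exists (fun s => k1 (gam (s, w.2))), (fun s => - k2 (gam (w.1, s))),
    ((l1 z * rho z + l2 z * v z) / J z); split.
  - by apply/near_ball; exists 1 => // s _; have [] := gam_comp_grad (w := (s, w.2)) hh w2.
  - exact: k1x.
  - by apply: filterS n2 => s s0; have [] := gam_comp_grad (w := (w.1, s)) hh s0.
  - by apply: (der_val (derN k2y)); rewrite addrC.
exists (fun s => k2 (gam (s, w.2))), (fun s => k1 (gam (w.1, s))),
  ((l2 z * rho z - l1 z * v z) / J z); split.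
- by apply/near_ball; exists 1 => // s _; have [] := gam_comp_grad (w := (s, w.2)) hh w2.
- exact: k2x.
- by apply: filterS n2 => s s0; have [] := gam_comp_grad (w := (w.1, s)) hh s0.
- by apply: (der_val k1y); rewrite -[RHS]mulNr opprB.
Qed.

(* Real and imaginary parts of F F', where F' = al + i be. *)
Definition stretch_re z := rho z * al z - v z * be z.
Definition stretch_im z := rho z * be z + v z * al z.
Let N := stretch_re.
Let T := stretch_im.
Let a := cube_re c u v.
Let b := cube_im c u v.

Lemma cube_holo : holo eta a b
  (fun z => rho z * (3 * N z) - v z * (3 * T z))
  (fun z => rho z * (3 * T z) + v z * (3 * N z)).
Proof.
apply: holo_eq (holo_mul ceta (holo_mul ceta jet1 jet1) jet1) => z;
  by rewrite /a /b /N /T /cube_re /cube_im /stretch_re /stretch_im /rho; ring.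
Qed.

Lemma stretch_holo : exists l1 l2, holo eta N T l1 l2.
Proof.
by do 2 eexists; exact: (holo_mul ceta jet1 jet2).
Qed.

Lemma stretch3_holo : exists l1 l2,
  holo eta (fun z => 3 * N z) (fun z => 3 * T z) l1 l2.
Proof.
have [l1 [l2 h]] := stretch_holo; do 2 eexists.
by apply: holo_eq (holo_mul ceta (holo_cst ceta 3 0) h) => z //;
  rewrite /N /T; ring.
Qed.

(** * Monotonicity along the free surface *)

Let sl := derive1 eta.

Lemma q_below_surf x : q (x, eta x - t) @[t --> 0^'+] --> q (surf eta x).
Proof.
apply: (below_surf_cvg (A := cl_fluid eta)).
  exact: (@subspace_continuousP _ _ _ _).1 q_cont _ (surf_cl x).
by move=> t t0; rewrite /cl_fluid /= gerBl ltW.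
Qed.

(** Derivatives of [q] are given only inside the fluid, so the surface is approached by the parallel
    curves [eta - h]. Along them the derivative is [k], which is continuous up to the surface point;
    the mean value theorem gives an estimate uniform in [h], and [h] tends to 0. The form of the
    result uses the kinematic condition [v = - rho * sl]. *)
Lemma q_surf_der x : 0 < x < p2 ->
  der (fun t => q (surf eta t)) x (rho (surf eta x) * (1 + sl x ^+ 2)).
Proof.
move=> hx; have nc := not_crest hx.
pose k z := rho z - v z * sl z.1.
have kx : k (surf eta x) = rho (surf eta x) * (1 + sl x ^+ 2).
  by rewrite /k (surf_v hw nc) /rho /sl; ring.
have est e : 0 < e -> exists2 d : R, 0 < d & forall t, `|t - x| < d ->
    `|q (surf eta t) - q (surf eta x) - k (surf eta x) * (t - x)| <= e * `|t - x|.
  move=> e0.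
  have ck : k @ within (cl_fluid eta) (nbhs (surf eta x)) --> k (surf eta x).
    have cr := (@subspace_continuousP _ _ _ _).1 (rho_cont hw) _ (surf_cl x).
    have cvv := (@subspace_continuousP _ _ _ _).1 (ww_v_cont hww) _ (surf_cl x).
    apply: cvgB; first exact: cr.
    apply: cvgM; first exact: cvv.
    apply: cvg_within_filter.
    apply: (continuous_comp (f := fst) (g := sl)); first exact: cvg_fst.
    exact: (der_continuous (der_slope hw nc)).
  have nk : \forall z \near surf eta x, cl_fluid eta z ->
      `|k (surf eta x) - k z| < e.
    by move/cvgrPdist_lt : ck => /(_ e e0).
  move: nk => /near_box[d d0 hd].
  (* The vertical distance [d] is shared equally between the variation of [eta] and the offset
     [h]. *)
  have ne : \forall t \near x, `|eta x - eta t| < d / 2.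
    by have /cvgrPdist_lt/(_ (d / 2)) := ceta (x := x); apply; rewrite divr_gt0.
  have nx : \forall t \near x, 0 < t < p2.
    case/andP: hx => x0 x1; near=> t; apply/andP; split; near: t.
      exact: lt_nbhsr.
    exact: lt_nbhsl.
  have [d1 d10 hd1] := (near_ball x _).1 (filterI ne nx).
  exists (Num.min d d1); first by rewrite lt_min d0.
  move=> t; rewrite lt_min => /andP[td td1].
  have D (h : R) : 0 < h < d / 2 ->
      `|q (t, eta t - h) - q (x, eta x - h) - k (surf eta x) * (t - x)|
        <= e * `|t - x|.
    move=> /andP[h0 hd2].
    have [|y hy ->] := @mvt_between R (fun s => q (s, eta s - h))
        (fun s => k (s, eta s - h)) x t.
      move=> y hy; have yx := le_lt_trans (between_dist hy) td1.
      have [_ yr] := hd1 _ yx.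
      have hf : fluid eta (y, eta y - h) by rewrite /fluid /= ltrBlDr ltrDl.
      have [cq _] := hodograph_holo hf.
      apply: (der_val (der_comp2 (X := id) (Y := fun s => eta s - h) cq (der_id y)
        (derB (der_eta hw (not_crest yr)) (der_cst h y)))).
      by rewrite /k /sl /=; ring.
    rewrite -mulrBl normrM; apply: ler_wpM2r => //; rewrite distrC; apply: ltW.
    have yx := between_dist hy.
    have [y1 _] := hd1 _ (le_lt_trans yx td1).
    apply: hd => /=.
    - exact: le_lt_trans yx td.
    - have -> : eta y - h - eta x = - (eta x - eta y) - h by ring.
      apply: le_lt_trans (ler_normB _ _) _; rewrite normrN [`|h|]gtr0_norm //; lra.
    - by rewrite /cl_fluid /= gerBl ltW.
  have cD : `|q (t, eta t - h) - q (x, eta x - h) - k (surf eta x) * (t - x)|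
      @[h --> 0^'+] -->
      `|q (surf eta t) - q (surf eta x) - k (surf eta x) * (t - x)|.
    apply: cvg_norm; apply: cvgB; last exact: cvg_cst.
    by apply: cvgB; exact: q_below_surf.
  apply: (cvgr_to_le cD); near=> h; apply: D; apply/andP; split; near: h.
    exact: nbhs_right_gt.
  by apply: nbhs_right_lt; rewrite divr_gt0.
rewrite -kx; apply/is_derive1_caratheodory.
exists (fun t => if t == x then k (surf eta x)
  else (q (surf eta t) - q (surf eta x)) / (t - x)); split.
- move=> t; case: eqP => [->|/eqP]; first by rewrite !subrr mulr0.
  by rewrite -subr_eq0 => /divfK ->.
- apply/cvgrPdist_le => e e0; have [d d0 hd] := est e e0.
  apply/near_ball; exists d => // t td; rewrite eqxx.
  case: eqP => [_|/eqP ne]; first by rewrite subrr normr0 ltW.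
  have tx : t - x != 0 by rewrite subr_eq0.
  rewrite distrC -(ler_pM2r (x := `|t - x|)) ?normr_gt0 // -normrM mulrBl divfK //.
  exact: hd.
- by rewrite eqxx.
Unshelve. all: by end_near. Qed.

Lemma q_surf_shift x : q (surf eta (x + p2)) = q (surf eta x) + L.
Proof. by rewrite /surf (sw_eta_per hs) q_shift. Qed.

Lemma q_surf_mono x y : x <= y -> q (surf eta x) <= q (surf eta y).
Proof.
apply: (quasiperiodic_nondecreasing (f := fun x => q (surf eta x)) (@pi2_gt0 R) q_surf_shift).
move=> {x y} x y x0 xy y1.
apply: (nondecreasing_der (f := fun x => q (surf eta x)) xy
  (f' := fun x => rho (surf eta x) * (1 + sl x ^+ 2))).
- move=> t /andP[xt ty]; apply: q_surf_der.
  by rewrite (le_lt_trans x0 xt) (lt_le_trans ty y1).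
- move=> t /andP[xt ty].
  have ht : 0 < t < 2 * pi by rewrite (le_lt_trans x0 xt) (lt_le_trans ty y1).
  have r0 : 0 < rho (surf eta t) := surf_speed_gt0 hw (not_crest ht).
  by rewrite mulr_ge0 ?ltW // ltr_wpDr // sqr_ge0.
- exact: (surf_within ceta q_cont).
Qed.

Let rhoc := rho_cont hw.
Let vc : {within cl_fluid eta, continuous v} := ww_v_cont hww.

Lemma cube_re_cont : {within cl_fluid eta, continuous a}.
Proof.
rewrite (_ : a = fun z => rho z * (rho z * rho z) - 3 * rho z * (v z * v z)) //.
move=> z; apply: cvgB; apply: cvgM; try (by apply: cvgM; exact: vc);
  try (by apply: cvgM; exact: rhoc); first exact: rhoc.
by apply: cvgM; [exact: cvg_cst|exact: rhoc].
Qed.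

Lemma cube_im_cont : {within cl_fluid eta, continuous b}.
Proof.
rewrite (_ : b = fun z => 3 * (rho z * rho z) * v z - v z * (v z * v z)) //.
move=> z; apply: cvgB; apply: cvgM; try exact: vc;
  try (by apply: cvgM; exact: vc).
by apply: cvgM; [exact: cvg_cst|apply: cvgM; exact: rhoc].
Qed.

Let surf_shift x : [/\ rho (surf eta (x + p2)) = rho (surf eta x) &
  v (surf eta (x + p2)) = v (surf eta x)].
Proof.
rewrite /surf (sw_eta_per hs); split.
  by have := rho_shift (surf_cl x); rewrite mul1r.
by have := v_shift (surf_cl x); rewrite mul1r.
Qed.

(** The function [m] is quasiperiodic, continuous at the crests, and nondecreasing between them by
    [cube_im_der]. *)
Lemma cube_im_surf_le x y : x <= y ->
  b (surf eta y) - b (surf eta x) <=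
  3 * g / 2 * (q (surf eta y) - q (surf eta x)).
Proof.
move=> xy; pose m x := 3 * g / 2 * q (surf eta x) - b (surf eta x).
suff : m x <= m y by rewrite /m; lra.
apply: (quasiperiodic_nondecreasing (f := m) (C := 3 * g / 2 * L) (@pi2_gt0 R)) xy.
  move=> t; rewrite /m q_surf_shift /b /cube_im.
  by have [] := surf_shift t; rewrite /rho => -> ->; ring.
move=> {x y} x y x0 xy y1.
(* The derivative is made available at every [t], with default 0 outside the period, so that
   [choice] yields a function. *)
have hd t : exists d, 0 < t < p2 ->
    der (fun t => b (surf eta t)) t d /\
    d <= 3 * g / 2 * (rho (surf eta t) * (1 + sl t ^+ 2)).
  have [ht|ht] := boolP (0 < t < p2); last by exists 0.
  by have [d h1 h2] := cube_im_der hg hw ht; exists d.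
have [b' hb] := choice hd.
apply: (nondecreasing_der (f := m) xy
  (f' := fun t => 3 * g / 2 * (rho (surf eta t) * (1 + sl t ^+ 2)) - b' t)).
- move=> t /andP[xt ty].
  have ht : 0 < t < p2 by rewrite (le_lt_trans x0 xt) (lt_le_trans ty y1).
  have [h1 _] := hb t ht.
  exact: (derB (derZ (3 * g / 2) (q_surf_der ht)) h1).
- move=> t /andP[xt ty].
  have ht : 0 < t < p2 by rewrite (le_lt_trans x0 xt) (lt_le_trans ty y1).
  by have [_ h2] := hb t ht; rewrite subr_ge0.
- move=> t; apply: cvgB; last exact: (surf_within ceta cube_im_cont).
  by apply: cvgM; [exact: cvg_cst|exact: (surf_within ceta q_cont)].
Qed.

(** * Bounds on the direction of the velocity *)

Lemma v_sides y : (y <= eta 0 -> v (0, y) = 0) /\ (y <= eta pi -> v (pi, y) = 0).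
Proof.
split=> hy.
  by have := v_neg (z := (0, y)) hy; rewrite /= mulr0 addr0; lra.
have hy' : y <= eta (- pi) by rewrite (eta_even hw).
have := v_neg (z := (pi, y)) hy; rewrite /= mulN1r addr0.
have := v_shift (z := (- pi, y)) hy'; rewrite /= mul1r.
have -> : - pi + p2 = pi by rewrite /p2; move: pi => t; ring.
by lra.
Qed.

(** Maximum principle for - v in the half-period strip: [v] vanishes on the crest and trough lines,
    and on the surface [v = - rho * sl] with [sl <= 0]. *)
Lemma v_ge0 z : cl_fluid eta z -> 0 <= z.1 <= pi -> 0 <= v z.
Proof.
move=> hz z1; have [K hK] := flow_bounded hg hc hw.
(* Written in the shape of [harmonic_at_lin], with the constant 0 as its first function. *)
pose h (z : R * R) := 0 + -1 * v z + 0.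
suff : h z <= 0 by rewrite /h; lra.
apply: (@max_principle R (cl_fluid eta `&` [set z | 0 <= z.1 <= pi]) h (eta 0) K) => //.
- by apply: closedI; [exact: closed_cl_fluid|exact: closed_strip].
- by move=> w [hw' _]; apply: le_trans hw' (eta_le0 hg hw _).
- move=> w; apply: cvgD; last exact: cvg_cst.
  apply: cvgD; first exact: cvg_cst.
  apply: cvgM; first exact: cvg_cst.
  exact: (continuous_subspaceW (@subIsetl _ _ _) vc).
- move=> w [hw' _]; have [_] := hK _ hw'; rewrite /h ler_norml; lra.
- move=> w [hw' /andP[w1 w2]] hpos.
  have vneg : v w < 0 by move: hpos; rewrite /h; lra.
  have w10 : w.1 != 0.
    apply: contraTneq vneg => w0; rewrite (surjective_pairing w) w0.
    have [h0 _] := v_sides w.2; rewrite h0 ?ltxx //.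
    by move: hw'; rewrite /cl_fluid /= w0.
  have w1p : w.1 != pi.
    apply: contraTneq vneg => w0; rewrite (surjective_pairing w) w0.
    have [_ h0] := v_sides w.2; rewrite h0 ?ltxx //.
    by move: hw'; rewrite /cl_fluid /= w0.
  have {}w1 : 0 < w.1 by rewrite lt_def w10.
  have {}w2 : w.1 < pi by rewrite lt_neqAle w1p.
  have w12 : 0 < w.1 < 2 * pi by rewrite w1 (lt_trans w2) // mulr_natl mulr2n ltrDl pi_gt0.
  have [fw|ws] := cl_fluidP hw'; last first.
    have r0 : 0 < rho (surf eta w.1) := surf_speed_gt0 hw (not_crest w12).
    have s0 := slope_le0 hw w1 (ltW w2).
    move: vneg; rewrite {1}ws (surf_v hw (not_crest w12)) -/(rho _).
    by rewrite ltNge oppr_ge0 pmulr_rle0 // s0.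
  split.
    apply: filterI; last by apply: strip_nbhs; rewrite w1.
    by apply: filterS (fluid_nbhs ceta fw) => t; exact: fluid_cl.
  have [_ hv] := holo_harmonic ceta jet1 jet2 fw.
  exact: harmonic_at_lin (harmonic_at_cst 0 w) hv.
Qed.

(** Maximum principle for v - rho: on the surface [v = - rho * sl], and the slope is at least -1 by
    [slope_bound]; at the crests both sides vanish. *)
Lemma v_le_rho z : cl_fluid eta z -> v z <= rho z.
Proof.
move=> hz; have [K hK] := flow_bounded hg hc hw.
pose h (z : R * R) := v z + -1 * rho z + 0.
suff : h z <= 0 by rewrite /h; lra.
apply: (@max_principle R (cl_fluid eta) h (eta 0) (K + K)) => //.
- exact: closed_cl_fluid.
- by move=> w hw'; apply: le_trans hw' (eta_le0 hg hw _).
- move=> w; apply: cvgD; last exact: cvg_cst.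
  apply: cvgD; first exact: vc.
  by apply: cvgM; [exact: cvg_cst|exact: rhoc].
- move=> w hw'; have [] := hK _ hw'; rewrite /h -/(rho w) !ler_norml.
  by move=> /andP[? ?] /andP[? ?]; lra.
- move=> w hw' hpos.
  have [fw|ws] := cl_fluidP hw'; last first.
    have [m /andP[m0 m1]] := mod_period w.1 (@pi2_gt0 R).
    set x := w.1 + _ in m0 m1.
    have eu : rho (surf eta x) = rho (surf eta w.1).
      by rewrite /rho /surf /x (eta_per hw) (field_per hw (sw_u_per hs)).
    have ev : v (surf eta x) = v (surf eta w.1).
      by rewrite /surf /x (eta_per hw) (field_per hw (sw_v_per hs)).
    move: hpos; rewrite /h ws -eu -ev.
    move: m0; rewrite le_eqVlt => /predU1P[<-|m0].
      have [u0 v0] := esw_stagnation hw (@crest0 R).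
      by rewrite /rho u0 v0; lra.
    have hx : 0 < x < 2 * pi by rewrite m0.
    have r0 : 0 < rho (surf eta x) := surf_speed_gt0 hw (not_crest hx).
    have sb := slope_bound hw hx.
    rewrite (surf_v hw (not_crest hx)) -/(rho _) -/sl.
    have s1 : -1 <= sl x by rewrite /sl; nra.
    by nra.
  split.
    by apply: filterS (fluid_nbhs ceta fw) => t; exact: fluid_cl.
  have [hr hv] := holo_harmonic ceta jet1 jet2 fw.
  exact: harmonic_at_lin hv hr.
Qed.

(** * Bounds on N and T by the maximum principle in the half plane *)

Lemma closed_lower : closed (@lower_half_plane R).
Proof.
rewrite (_ : lower_half_plane = snd @^-1` [set t : R | t <= 0]) //.
by apply: closed_comp; [move=> z _; exact: cvg_snd|exact: closed_le].
Qed.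

Lemma lower_nbhs (w : R * R) : w.2 < 0 -> nbhs w lower_half_plane.
Proof.
move=> w2; have : \forall t \near w.2, t < 0 by exact: lt_nbhsl.
move=> /near_ball[d d0 hd]; apply/near_box; exists d => // x y _ hy.
by apply: ltW; exact: hd.
Qed.

Let lower_affine (f : R * R -> R) (k l : R) :
  {within cl_fluid eta, continuous f} ->
  {within lower_half_plane, continuous (fun w => f (gam (k * w.1 + l, w.2)))}.
Proof.
move=> cf; apply: (within_comp (k := fun w : R * R => gam (k * w.1 + l, w.2)) cf);
  last by move=> w hwl; have [] := @hout (k * w.1 + l, w.2) hwl.
apply: (within_comp (k := fun w : R * R => (k * w.1 + l, w.2)) gam_cont) => //.
apply: continuous_subspaceT => z.
apply: (@cvg_pair _ _ _ _ (nbhs (k * z.1 + l)) (nbhs z.2) _ _ _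
  (fun w : R * R => k * w.1 + l) snd); last exact: cvg_snd.
apply: cvgD; last exact: cvg_cst.
by apply: cvgM; [exact: cvg_cst|exact: cvg_fst].
Qed.

Let lower_comp (f : R * R -> R) : {within cl_fluid eta, continuous f} ->
  {within lower_half_plane, continuous (fun w => f (gam w))}.
Proof.
move=> cf; apply: (within_comp (k := gam) cf gam_cont).
by move=> w /hout[].
Qed.

Lemma cubes_bounded : exists K, forall z, cl_fluid eta z ->
  `|a z| <= K /\ `|b z| <= K.
Proof.
have [K hK] := flow_bounded hg hc hw.
exists (4 * K ^+ 3) => z hz; have [rK vK] : `|rho z| <= K /\ `|v z| <= K := hK _ hz.
have K0 : 0 <= K by apply: le_trans rK; exact: normr_ge0.
have P3 (x y t : R) : `|x| <= K -> `|y| <= K -> `|t| <= K -> `|x * y * t| <= K ^+ 3.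
  move=> hx hy ht; rewrite !normrM.
  by rewrite (_ : K ^+ 3 = K * K * K) ?ler_pM ?mulr_ge0 //; ring.
have N3 (x : R) : `|3 * x| = 3 * `|x| by rewrite normrM ger0_norm.
have rrr := P3 _ _ _ rK rK rK; have rvv := P3 _ _ _ rK vK vK.
have rrv := P3 _ _ _ rK rK vK; have vvv := P3 _ _ _ vK vK vK.
rewrite /a /b /cube_re /cube_im; split.
  rewrite (_ : _ - _ = rho z * rho z * rho z - 3 * (rho z * v z * v z)); last first.
    by rewrite /rho; ring.
  apply: le_trans (ler_normB _ _) _.
  by have := N3 (rho z * v z * v z); lra.
rewrite (_ : _ - _ = 3 * (rho z * rho z * v z) - v z * v z * v z); last first.
  by rewrite /rho; ring.
apply: le_trans (ler_normB _ _) _.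
by have := N3 (rho z * rho z * v z); lra.
Qed.

Let cubes_harmonic w : w.2 < 0 ->
  harmonic_at (fun w => a (gam w)) w /\ harmonic_at (fun w => b (gam w)) w.
Proof.
move=> w2; have [l1 [l2 h]] := stretch3_holo.
exact: gam_comp_harmonic cube_holo h w2.
Qed.

Let gam_surf_mono s t : s <= t -> (gam (s, 0)).1 <= (gam (t, 0)).1.
Proof.
move=> st; rewrite leNgt; apply/negP => h.
have l0 (r : R) : lower_half_plane (r, 0 : R) by rewrite /lower_half_plane /=.
have qE r : q (surf eta (gam (r, 0)).1) = r by rewrite -gam_surf q_gam.
have := q_surf_mono (ltW h); rewrite !qE => ts.
have e : s = t by apply/eqP; rewrite eq_le st.
by move: h; rewrite e ltxx.
Qed.

(** On p = 0 a translation by [t] increases [q] by exactly [t], so [cube_im_surf_le] makes the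
    boundary values of [h] nonpositive. The resulting bound on differences gives 3 T <= 3 g / 2 in
    the limit of small [t]. *)
Lemma stretch_im_le z : fluid eta z -> T z <= g / 2.
Proof.
move=> hz; pose w := (q z, p z).
have w2 : w.2 < 0 by exact: p_lt0.
have [hwl gw] := hin (fluid_cl hz).
have [K hK] := cubes_bounded.
have key t : 0 < t ->
    b (gam (w.1 + t, w.2)) - b (gam w) <= 3 * g / 2 * t.
  move=> t0.
  pose h (w : R * R) := b (gam (1 * w.1 + t, w.2)) + -1 * b (gam w) + - (3 * g / 2 * t).
  suff : h w <= 0 by rewrite /h mul1r; lra.
  apply: (@max_principle R lower_half_plane h 0 (K + K)) => //.
  - exact: closed_lower.
  - move=> y; apply: cvgD; last exact: cvg_cst.
    apply: cvgD; first exact: (lower_affine cube_im_cont).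
    by apply: cvgM; [exact: cvg_cst|exact: (lower_comp cube_im_cont)].
  - move=> y hy; have [c1 _] := hout hy.
    have [c2 _] := @hout (1 * y.1 + t, y.2) hy.
    have [_] := hK _ c1; have [_] := hK _ c2; rewrite /h !ler_norml.
    have : 0 < 3 * g / 2 * t by rewrite !mulr_gt0 // divr_gt0 // mulr_gt0.
    by move=> ? /andP[? ?] /andP[? ?]; lra.
  - move=> y hy hpos.
    have y2 : y.2 < 0.
      rewrite lt_neqAle (_ : y.2 <= 0) ?andbT //; apply: contraTneq hpos => y0.
      rewrite -leNgt /h mul1r; case: y hy y0 => y1 y2 /= _ ->.
      rewrite (gam_surf (y1 + t)) (gam_surf y1).
      have l0 (r : R) : lower_half_plane (r, 0 : R) by rewrite /lower_half_plane /=.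
      have le1 : y1 <= y1 + t by rewrite lerDl ltW.
      have := cube_im_surf_le (gam_surf_mono le1).
      by rewrite -!gam_surf !q_gam //=; lra.
    split; first exact: lower_nbhs.
    apply: harmonic_at_lin; last by have [] := cubes_harmonic y2.
    apply: (@harmonic_at_affine _ (fun w => b (gam w))); first by rewrite mulr1.
    by have [] := @cubes_harmonic (1 * y.1 + t, y.2) y2.
have [_ _ h _] := gam_comp_grad cube_holo w2.
have h' := derB (derZ (3 * g / 2) (der_id w.1)) h.
have := der_ge0_right (ltr01 : 0 < (1 : R)) h'.
have gwz : gam w = z by [].
rewrite gwz => H; suff : 0 <= 3 * g / 2 * 1 - 3 * T z by lra.
apply: H => t /andP[t0 _]; have := key t t0.
by rewrite gwz /w /=; lra.
Qed.

(** For the lower bound, the horizontal segment to the crest line stays in the fluid because [eta]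
    decreases from crest to trough. The segment towards the trough line may leave the fluid, so the
    upper bound first goes down, along which [q] does not decrease since q_y = - v <= 0, and then
    moves right at depth. *)
Lemma q_range z : fluid eta z -> 0 < z.1 < pi -> 0 <= q z <= L / 2.
Proof.
case: z => x y hz /= /andP[x0 xpi]; rewrite /fluid /= in hz.
have [Y [hY uY]] := deep_bound hc hw.
apply/andP; split.
  have hf t : 0 <= t <= x -> fluid eta (t, y).
    move=> /andP[t0 tx]; rewrite /fluid /=; apply: lt_le_trans hz _.
    by apply: (eta_decr hw) => //; exact: ltW.
  have d t : 0 <= t <= x -> der (fun s => q (s, y)) t (rho (t, y)).
    by move=> ht; have [] := dq (hf t ht).
  have d' t : 0 < t < x -> der (fun s => q (s, y)) t (rho (t, y)).
    by move=> /andP[? ?]; apply: d; rewrite !ltW.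
  have p' t : 0 < t < x -> 0 <= rho (t, y).
    move=> /andP[t0 tx]; have ht : 0 <= t <= x by rewrite !ltW.
    by have r0 : 0 < rho (t, y) := fluid_speed_gt0 hw (hf t ht); exact: ltW.
  have := nondecreasing_der (ltW x0) d' p' (der_within d).
  rewrite q_axis //; apply: ltW; apply: lt_le_trans hz _; exact: eta_le0 hg hw x.
pose Y1 := Num.min Y y - 1.
have [Y1Y Y1y] : Y1 < Y /\ Y1 < y.
  by rewrite /Y1; split; rewrite ltrBlDr !gt_min !ltrDl ltr01 ?orbT.
have h1 : q (x, y) <= q (x, Y1).
  have d t : Y1 < t < y -> der (fun s => - q (x, s)) t (v (x, t)).
    move=> /andP[_ ty]; have [_ k] := dq (z := (x, t)) (lt_trans ty hz).
    by have := derN k; rewrite opprK.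
  have d0 t : Y1 < t < y -> 0 <= v (x, t).
    move=> /andP[_ ty]; apply: v_ge0; first exact: ltW (lt_trans ty hz).
    by rewrite !ltW.
  have cN : {within `[Y1, y], continuous (fun s => - q (x, s))}.
    by move=> s; apply: cvgN; exact: (vertical_within q_cont (ltW hz)).
  by have := nondecreasing_der (ltW Y1y) d d0 cN; rewrite lerN2.
apply: le_trans h1 _; have YY t : fluid eta (t, Y1).
  by rewrite /fluid /=; apply: lt_trans (hY t).
rewrite -(q_pi (y := Y1)); last exact: ltW (YY pi).
apply: (nondecreasing_der (f := fun s => q (s, Y1)) (f' := fun s => rho (s, Y1))).
- exact: ltW.
- by move=> t _; have [] := dq (YY t).
- by move=> t _; have r0 : 0 < rho (t, Y1) := fluid_speed_gt0 hw (YY t); exact: ltW.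
- by apply: (der_within (f' := fun s => rho (s, Y1))) => t _; have [] := dq (YY t).
Qed.

Let a_neg x y : y <= eta x -> a (- x, y) = a (x, y).
Proof.
move=> h; rewrite /a /cube_re; have := rho_neg (z := (x, y)) h; have := v_neg (z := (x, y)) h.
by rewrite /= mulN1r addr0 /rho => -> ->; rewrite sqrrN.
Qed.

Let a_gam_neg w : lower_half_plane w -> a (gam (- w.1, w.2)) = a (gam w).
Proof.
move=> hwl; have [hcl _] := hout hwl.
by rewrite gam_neg // a_neg // -surjective_pairing.
Qed.

Let a_gam_shift w : lower_half_plane w -> a (gam (w.1 + L, w.2)) = a (gam w).
Proof.
move=> hwl; have [hcl _] := hout hwl.
rewrite gam_shift // /a /cube_re; have := rho_shift hcl; have := v_shift hcl.
by rewrite mul1r /rho => -> ->.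
Qed.

Lemma cube_re_reflect (l t : R) : 0 <= l -> l <= L / 2 -> l <= t -> t <= l + L / 2 ->
  a (gam (2 * l - t, 0)) <= a (gam (t, 0)).
Proof.
have l0 (r : R) : lower_half_plane (r, 0 : R) by rewrite /lower_half_plane /=.
apply: (@reflect_le R (fun t => a (gam (t, 0)))).
- by move=> x; exact: (a_gam_neg (l0 x)).
- by move=> x; exact: (a_gam_shift (l0 x)).
move=> x y x0 xy yL.
rewrite (gam_surf x) (gam_surf y).
have g0 : (gam (0, 0)).1 = 0.
  have [_] := hin (surf_cl 0); rewrite -/(q _) -/(p _) q0 p0 => ->; by [].
have gL : (gam (L / 2, 0)).1 = pi.
  have [_] := hin (surf_cl pi); rewrite -/(q _) -/(p _) p_surf.
  by rewrite /surf q_pi // => ->.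
apply: (cube_re_mono hg hw).
- by have := gam_surf_mono x0; rewrite g0.
- exact: gam_surf_mono.
- by have := gam_surf_mono yL; rewrite gL.
Qed.

(** Reflection in the line q = l through the image of [z], on a strip of width [L / 2]: [h] vanishes
    on q = l trivially and on q = l + L / 2 because there the reflected point differs by the period
    [L]; on p = 0 it is nonpositive by [cube_re_reflect]. At q = l the antisymmetric difference has
    derivative 6 N. *)
Lemma stretch_re_ge0 z : fluid eta z -> 0 < z.1 < pi -> 0 <= N z.
Proof.
move=> hz z1; have /andP[l0 lL] := q_range hz z1.
pose w := (q z, p z); set l := q z in w l0 lL.
have w2 : w.2 < 0 by exact: p_lt0.
have [hwl gw] := hin (fluid_cl hz).
have [K hK] := cubes_bounded.
have L0 := q_period_gt0; rewrite -/L in L0.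
pose h (w : R * R) := a (gam (-1 * w.1 + 2 * l, w.2)) + -1 * a (gam w) + 0.
have key t : 0 < t < L / 2 -> h (l + t, w.2) <= 0.
  move=> /andP[t0 tL].
  pose S : set (R * R) := lower_half_plane `&` [set z | l <= z.1 <= l + L / 2].
  apply: (@max_principle R S h 0 (K + K)) => //.
  - by apply: closedI; [exact: closed_lower|exact: closed_strip].
  - by move=> y [].
  - have SS : S `<=` lower_half_plane by move=> ? [].
    have c1 := continuous_subspaceW SS (lower_affine cube_re_cont).
    have c2 := continuous_subspaceW SS (lower_comp cube_re_cont).
    move=> y; apply: cvgD; last exact: cvg_cst.
    apply: cvgD; first exact: c1.
    by apply: cvgM; [exact: cvg_cst|exact: c2].
  - move=> y [hy _]; have [c1 _] := hout hy.
    have [c2 _] := @hout (-1 * y.1 + 2 * l, y.2) hy.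
    have [+ _] := hK _ c1; have [+ _] := hK _ c2; rewrite /h !ler_norml.
    by move=> /andP[? ?] /andP[? ?]; lra.
  - move=> y [hy /andP[y1 y2]] hpos.
    have yl : y.1 != l.
      apply: contraTneq hpos => e; rewrite -leNgt /h e.
      rewrite (_ : -1 * l + 2 * l = l); last by ring.
      by rewrite -{1}e -surjective_pairing; lra.
    have yL : y.1 != l + L / 2.
      apply: contraTneq hpos => e; rewrite -leNgt /h.
      have := a_gam_shift (w := (-1 * y.1 + 2 * l, y.2)) hy => /=.
      rewrite (_ : -1 * y.1 + 2 * l + L = y.1); last by rewrite e; field.
      by rewrite -surjective_pairing => ->; lra.
    have y20 : y.2 < 0.
      rewrite lt_neqAle (_ : y.2 <= 0) ?andbT //; apply: contraTneq hpos => e.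
      rewrite -leNgt /h; case: y hy y1 y2 e {yl yL} => s r /= _ s1 s2 ->.
      rewrite mulN1r [- s + _]addrC.
      by have := cube_re_reflect l0 lL s1 s2; lra.
    split.
      apply: filterI; first exact: lower_nbhs.
      by apply: strip_nbhs; rewrite !lt_neqAle y1 y2 eq_sym yl yL.
    apply: harmonic_at_lin; last by have [] := cubes_harmonic y20.
    apply: (@harmonic_at_affine _ (fun w => a (gam w))); first by rewrite mulrNN mulr1.
    by have [] := @cubes_harmonic (-1 * y.1 + 2 * l, y.2) y20.
  - by split => //=; lra.
have [d _ _ _] := gam_comp_grad cube_holo w2.
have d' : der (fun s => a (gam (-1 * s + 2 * l, w.2))) l (-1 * (3 * N (gam w))).
  apply: (der_affine (u := fun s => a (gam (s, w.2)))).
  by rewrite (_ : -1 * l + 2 * l = l) //; ring.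
have L2 : 0 < L / 2 by lra.
have := der_ge0_right L2 (derB d d').
have gwz : gam w = z by [].
rewrite gwz => H; suff : 0 <= 3 * N z - -1 * (3 * N z) by lra.
apply: H => t ht; have := key t ht; rewrite /h /=.
rewrite (_ : -1 * l + 2 * l = l); last by ring.
by rewrite gwz subrr; lra.
Qed.

(** * The vertical pressure gradient in the half period and on the crest line *)

Lemma normal_stretch_le z : fluid eta z -> 0 <= z.1 <= pi ->
  rho z * be z - v z * al z <= g / 2.
Proof.
move=> hz z1; have hT := stretch_im_le hz.
have v0 := v_ge0 (fluid_cl hz) z1; have vr := v_le_rho (fluid_cl hz).
have r0 : 0 < rho z := fluid_speed_gt0 hw hz.
(* [stretch_re_ge0] leaves out the crest and trough lines, where [v] and therefore the product
   vanish. *)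
have vN : 0 <= v z * N z.
  have [z0|/eqP vn0] := eqVneq (v z) 0; first by rewrite z0 mul0r.
  apply: mulr_ge0 => //; apply: stretch_re_ge0 => //.
  have [s0 s1] := v_sides z.2.
  case/andP: z1 => z10 z1p; apply/andP; split; rewrite lt_neqAle ?z10 ?z1p andbT.
    apply/eqP => e; apply: vn0; rewrite (surjective_pairing z) -e; apply: s0.
    by rewrite e; exact: fluid_cl.
  apply/eqP => e; apply: vn0; rewrite (surjective_pairing z) e; apply: s1.
  by rewrite -e; exact: fluid_cl.
have Jz := J0 hz.
have E : J z * (rho z * be z - v z * al z) =
    (rho z ^+ 2 - v z ^+ 2) * T z - 2 * rho z * (v z * N z).
  by rewrite /J /T /N /stretch_im /stretch_re -/rho; ring.
have rv : 0 <= rho z ^+ 2 - v z ^+ 2 by nra.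
rewrite -(ler_pM2l Jz) E.
have h1 := ler_wpM2l rv hT.
have h2 : 0 <= 2 * rho z * (v z * N z) by rewrite mulr_ge0 // mulr_ge0 // ltW.
have h3 : (rho z ^+ 2 - v z ^+ 2) * (g / 2) <= J z * (g / 2).
  apply: ler_wpM2r; first by rewrite divr_ge0 // ltW.
  by rewrite /J; have := sqr_ge0 (v z); lra.
by lra.
Qed.

(** On the crest line [v] vanishes by oddness, and [al], the x-derivative of the even function
    [rho], vanishes too. *)
Lemma stretch_axis y : y < eta 0 -> N (0, y) = 0.
Proof.
move=> hy; have hz : fluid eta (0, y) by [].
have [v0 _] := v_sides y.
have [[r1 _] _] := holo_partials jet1 hz.
have r2 : der (fun s => rho (-1 * s + 0, y)) 0 (-1 * al (0, y)).
  by apply: (der_affine (u := fun s => rho (s, y))); rewrite mulr0 addr0.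
have nx : \forall s \near (0 : R), fluid eta (s, y).
  move/near_box : (fluid_nbhs ceta hz) => [d d0 hd]; apply/near_ball.
  by exists d => // s sd; apply: hd => //; rewrite subrr normr0.
have e : al (0, y) = -1 * al (0, y).
  apply: der_unique r1 r2; apply: filterS nx => s hs'.
  by have := rho_neg (fluid_cl hs').
rewrite /N /stretch_re v0 ?ltW // mul0r subr0.
by rewrite (_ : al (0, y) = 0) ?mulr0 //; lra.
Qed.

(* By the Cauchy-Riemann equations T_y = N_x, and on the crest line N vanishes
   while N >= 0 to the right of it. *)
Lemma stretch_im_axis_mono y1 y2 : y1 <= y2 -> y2 < eta 0 ->
  T (0, y1) <= T (0, y2).
Proof.
move=> y12 y20; have [l1 [l2 hS]] := stretch_holo.
have hz y : y1 <= y <= y2 -> fluid eta (0, y).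
  by move=> /andP[_ h]; rewrite /fluid /=; exact: le_lt_trans y20.
have d y : y1 <= y <= y2 -> der (fun s => T (0, s)) y (l1 (0, y)).
  by move=> /hz /(holo_partials hS)[_ []].
apply: (nondecreasing_der (f := fun s => T (0, s)) y12 (f' := fun s => l1 (0, s))).
- by move=> y /andP[h1 h2]; apply: d; rewrite !ltW.
- move=> y /andP[h1 h2]; have hy : fluid eta (0, y) by apply: hz; rewrite !ltW.
  have [[dN _] _] := holo_partials hS hy.
  move/near_box : (fluid_nbhs ceta hy) => [e e0 he].
  apply: (@der_ge0_right _ _ _ _ (Num.min e pi) _ dN).
    by rewrite lt_min e0 pi_gt0.
  move=> t; rewrite lt_min => /and3P[t0 te tp].
  rewrite stretch_axis // add0r; apply: stretch_re_ge0; last by rewrite /= t0.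
  by apply: he => /=; rewrite ?subrr ?normr0 // subr0 gtr0_norm.
- exact: (der_within d).
Qed.

End Hodograph.

(** * The pressure *)

Section Pressure.
Context {R : realType} (g c P0 : R) (eta : R -> R) (u v P : R * R -> R).
Context (hg : 0 < g) (hc : 0 < c).
Context (hw : extreme_stokes_wave g c P0 eta u v P).

Let hs := esw_stokes hw.
Let hww := sw_wave hs.
Let ceta : continuous eta := wave_eta_cont hw.

(** Periodicity and evenness bring every vertical line to the half period where [normal_stretch_le]
    applies. *)
Lemma pressure_fold x : exists x', [/\ 0 <= x' <= pi, eta x' = eta x &
  forall y, y <= eta x -> P (x', y) = P (x, y)].
Proof.
have [m /andP[m0 m1]] := mod_period x (@pi2_gt0 R).
set t := x + _ in m0 m1.
have et : eta t = eta x by exact: (eta_per hw).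
have Pt y : y <= eta x -> P (t, y) = P (x, y).
  by move=> hy; exact: (field_per hw (sw_P_per hs)).
have [tp|tp] := leP t pi; first by exists t; rewrite m0.
exists (- t + 2 * pi); split.
- by move: tp m1; move: (pi : R) => p tp m1; apply/andP; lra.
- by rewrite (sw_eta_per hs) (eta_even hw).
- move=> y hy; rewrite -Pt //.
  have h : cl_fluid eta (t, y) by rewrite /cl_fluid /= et.
  have h' : cl_fluid eta (- t, y) by rewrite /cl_fluid /= (eta_even hw) et.
  by rewrite (sw_P_per hs h') (sw_P_even hs h).
Qed.

(** The bound is kept at [- (g / 2)] because a mere strict inequality would not survive the limits
    at the surface and at the crest. On the crest line [v = 0] reduces the normal term to T, whose
    monotonicity makes [D] monotone. *)
Lemma pressure_fluid : (forall z, fluid eta z -> 'D_ey P z <= - (g / 2)) /\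
  exists D : R -> R, [/\
    forall y, y < eta 0 -> der (fun s => P (0, s)) y (D y),
    forall y, y < eta 0 -> D y <= - (g / 2) &
    forall y1 y2, y1 <= y2 -> y2 < eta 0 -> D y1 <= D y2].
Proof.
have [al [be [al2 [be2 [j1 j2 j3]]]]] := flow_jets hw.
have [gam [[phi [psi [hphi hpsi hin hout]]] _]] := esw_limit hw.
pose M (z : R * R) := (c - u z) * be z - v z * al z.
have hM z : fluid eta z -> 0 <= z.1 <= pi -> M z <= g / 2.
  exact: (normal_stretch_le hg hc hw j1 j2 hphi hpsi hin hout).
have axis y : y < eta 0 -> M (0, y) = stretch_im c u v al be (0, y).
  move=> hy; have [v0 _] := v_sides hw y.
  by rewrite /M /stretch_im v0 ?ltW // !mul0r subr0 addr0.
split.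
  case=> x y hz; have [x' [hx' ex hP]] := pressure_fold x.
  have hz' : fluid eta (x', y) by rewrite /fluid /= ex.
  have [-> [_ d]] := j3 _ hz; have [_ [_ d']] := j3 _ hz'.
  have ny : \forall s \near y, P (x', s) = P (x, s).
    by apply: filterS (lt_nbhsl hz) => s /= h; rewrite hP // ltW.
  rewrite -(der_unique ny d' d).
  by have := hM _ hz' hx'; rewrite /M; lra.
have z0 : 0 <= (0 : R) <= pi by rewrite lexx pi_ge0.
exists (fun y => - g + M (0, y)); split.
- by move=> y hy; have [_ [_ d]] := j3 (0, y) hy; exact: d.
- by move=> y hy; have := hM (0, y) hy z0; lra.
- move=> y1 y2 y12 y20; rewrite !axis //; last exact: le_lt_trans y20.
  rewrite lerD2l.
  exact: (stretch_im_axis_mono hg hc hw j1 j2 hphi hpsi hin hout).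
Qed.

Lemma pressure_surf x : ~ crest x -> exists2 l : R, l < 0 &
  'D_ey P z @[z --> within (fluid eta) (nbhs (surf eta x))] --> l.
Proof.
move=> hx; have [Q [cQ _ _ hQ]] := smooth_jet hw (ww_P_smooth hww).
have [hP _] := pressure_fluid.
have hr : reg_fluid crest eta (surf eta x) by right.
have lim : 'D_ey P z @[z --> within (fluid eta) (nbhs (surf eta x))] -->
    Q 0%N 1%N (surf eta x).
  move=> B HB.
  have := (@subspace_continuousP _ _ _ _).1 (cQ 0%N 1%N) _ hr B HB.
  rewrite /= !nbhs_simpl /within /=; apply: filterS => z hB hz.
  by have [_ _ ->] := hQ z hz; apply: hB; left.
exists (Q 0%N 1%N (surf eta x)) => //.
have below t : 0 < t -> fluid eta (x, eta x - t).
  by move=> t0; rewrite /fluid /= gtrBl.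
have lim' := below_surf_cvg lim below.
apply: (@le_lt_trans _ _ (- (g / 2))); last by rewrite oppr_lt0 divr_gt0.
apply: (cvgr_to_le lim'); near=> t; apply: hP; apply: below.
by near: t; exact: nbhs_right_gt.
Unshelve. all: by end_near. Qed.

Lemma pressure_crest x : crest x -> exists2 l : R, l < 0 &
  (P (x, y) - P (surf eta x)) / (y - eta x) @[y --> (eta x)^'-] --> l.
Proof.
move=> [m xm]; have [_ [D [dD bD mD]]] := pressure_fluid.
have x0 : x = 0 + 2 * pi * m%:~R by rewrite add0r.
have ex : eta x = eta 0 by rewrite x0 (eta_per hw).
have Px y : y <= eta 0 -> P (x, y) = P (0, y).
  by move=> hy; rewrite x0 (field_per hw (sw_P_per hs)).
rewrite /surf ex Px //.
have cD : cvg (D y @[y --> (eta 0)^'-]).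
  apply: nondecreasing_at_left_is_cvgr.
    apply: nearW => t y1 y2; rewrite !in_itv /= => _ /andP[_ h2] h.
    exact: mD.
  apply: nearW => t; exists (- (g / 2)) => d [y] /=.
  by rewrite in_itv /= => /andP[_ h2] <-; exact: bD.
set l := lim _ in cD.
exists l.
  apply: (@le_lt_trans _ _ (- (g / 2))); last by rewrite oppr_lt0 divr_gt0.
  apply: (cvgr_to_le cD); near=> y; apply: bD.
  by near: y; exact: nbhs_left_lt.
have Dl y : y < eta 0 -> D y <= l.
  move=> hy; apply: (cvgr_to_ge cD); near=> t; apply: mD.
    by apply: ltW; near: t; exact: nbhs_left_gt.
  by near: t; exact: nbhs_left_lt.
(* By the mean value theorem the difference quotient equals [D t] for some [t] between [y] and the
   crest; monotonicity of [D] squeezes it between [D y] and the limit [l]. *)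
have sq y : y < eta 0 -> D y <= (P (x, y) - P (0, eta 0)) / (y - eta 0) <= l.
  move=> hy; rewrite Px ?(ltW hy) //.
  have d t : y < t < eta 0 -> der (fun s => P (0, s)) t (D t).
    by move=> /andP[_]; exact: dD.
  have cP : {within `[y, eta 0], continuous (fun s => P (0, s))}.
    exact: (vertical_within (ww_P_cont hww) (lexx (eta 0))).
  have [t /andP[yt t0] e] := mvt hy d cP.
  rewrite -opprB e -[y - eta 0]opprB mulNr invrN mulrN opprK.
  rewrite mulfK ?gt_eqF ?subr_gt0 // Dl // andbT.
  by apply: mD => //; exact: ltW.
apply: (squeeze_cvgr _ cD (cvg_cst l)).
near=> y; apply: sq; near: y; exact: nbhs_left_lt.
Unshelve. all: by end_near. Qed.

End Pressure.

(* P_y < 0 in the fluid, at the regular surface points (where P_y is the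
   continuous extension from the fluid), and at the crests (where P_y is the
   one-sided derivative from below). *)
Theorem theorem5p2 (R : realType) (g c P0 : R) (eta : R -> R)
    (u v P : R * R -> R)
    (hg : 0 < g) (hc : 0 < c)
    (hwave : extreme_stokes_wave g c P0 eta u v P) :
  [/\ forall z : R * R, fluid eta z -> 'D_ey P z < 0,
      forall x : R, ~ crest x ->
        exists2 l : R, l < 0 &
          'D_ey P z @[z --> within (fluid eta) (nbhs (surf eta x))] --> l &
      forall x : R, crest x ->
        exists2 l : R, l < 0 &
          (P (x, y) - P (surf eta x)) / (y - eta x) @[y --> (eta x)^'-] --> l].
Proof.
split.
- move=> z hz; have [hP _] := pressure_fluid hg hc hwave.
  by apply: (le_lt_trans (hP z hz)); rewrite oppr_lt0 divr_gt0.
- by move=> x hx; exact: (pressure_surf hg hc hwave hx).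
- by move=> x hx; exact: (pressure_crest hg hc hwave hx).
Qed.
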